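(* Let $(G,H,\sigma)$ be a reduced $1$-dimensional Hecke triple, let $(G_\sigma,H_\sigma,\sigma)$ be its Schlichting completion, and assume that the set $$B=\{x\in G\mid \sigma(h)=\sigma(x^{-1}hx)\text{ for all }h\in H\cap xHx^{-1}\}$$ is a subgroup of $G$. Let $B_\sigma$ be the subgroup $$B_\sigma=\{x\in G_\sigma\mid \sigma(h)=\sigma(x^{-1}hx)\text{ for all }h\in H_\sigma\cap xH_\sigma x^{-1}\}$$ of $G_\sigma$. Then $\mathcal{H}_\sigma(G,H)$ is isomorphic (as a $*$-algebra) to $p_\sigma C_c(B_\sigma)p_\sigma$.
   Context: A Hecke pair $(G,H)$ is a group $G$ with a subgroup $H$ such that $[H:H\cap xHx^{-1}]<\infty$ for all $x\in G$. The Hecke topology from $(G,H)$ is the group topology on $G$ with $\{xHx^{-1}\mid x\in G\}$ as neighbourhood subbase at $e$; the pair is reduced if $\bigcap_{x\in G}xHx^{-1}=\{e\}$. The Schlichting completion of a reduced Hecke pair consists of the completion of $G$ in the Hecke topology (locally compact, totally disconnected) and the closure of the subgroup in it (compact open). A $1$-dimensional Hecke triple $(G,H,\sigma)$ is a Hecke pair $(G,H)$ with a unitary character $\sigma:H\to\mathbb{T}$ with finite range; $K=\ker\sigma$; it is reduced if the Hecke pair $(G,K)$ is. Its Schlichting completion $(G_\sigma,H_\sigma,\sigma)$: $(G_\sigma,K_\sigma)$ is the Schlichting completion of $(G,K)$, $H_\sigma$ is the closure of $H$ in $G_\sigma$ (compact open), and $\sigma$ denotes also the unique continuous extension to $H_\sigma$.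 $\mathcal{H}_\sigma(G,H)$ is the $*$-algebra of functions $f:G\to\mathbb{C}$ with finite support in $H\backslash G/H$ and $f(hxk)=\sigma(h)f(x)\sigma(k)$ for $h,k\in H$, $x\in G$, with convolution $f*g(x)=\sum_{yH\in G/H}f(y)g(y^{-1}x)$ and involution $f^*(x)=\Delta_K(x^{-1})\overline{f(x^{-1})}$, where $\Delta_K(x)=[K:K\cap xKx^{-1}]/[K:K\cap x^{-1}Kx]$. The set $B_\sigma$ is the closure of $B$ in $G_\sigma$; it contains $H_\sigma$ and is open and closed, and is a locally compact group when $B$ is a group. Its Haar measure is normalised so that $H_\sigma$ has measure $1$. $C_c(B_\sigma)$ has the usual convolution and involution $f^*(x)=\Delta(x^{-1})\overline{f(x^{-1})}$, $\Delta$ being the modular function, and $p_\sigma\in C_c(B_\sigma)$ is the projection $p_\sigma(x)=\chi_{H_\sigma}(x)\sigma(x)$. *)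

(* Defs.v *)
From HB Require Import structures.
From mathcomp Require Import all_boot all_order all_algebra.
From mathcomp Require Import all_classical all_reals all_analysis.
From mathcomp Require Import finmap complex.

Set Implicit Arguments.
Unset Strict Implicit.
Unset Printing Implicit Defensive.

Import Order.TTheory GRing.Theory Num.Theory numFieldNormedType.Exports.

Local Open Scope classical_set_scope.
Local Open Scope complex_scope.
Local Open Scope ring_scope.
Local Open Scope group_scope.

HB.mixin Record isTopologicalGroup T & Group T & Topological T := {
  mulg_continuous : continuous (fun x : T * T => x.1 * x.2);
  invg_continuous : continuous (fun x : T => x^-1)
}.

(* A base point is required only because g_sigma_algebraType needs one. *)
#[short(type="topologicalGroupType")]
HB.structure Definition TopologicalGroup :=
  {T of Group T & PointedTopological T & isTopologicalGroup T}.

Section HeckePairs.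
Variable G : groupType.
Implicit Types (H K : set G) (x : G).

Definition subgroup H := group_closed (mem H).

Definition lcoset H x : set G := [set x * h | h in H].

Definition dcoset H x : set G := [set h * x * k | h in H & k in H].

(* x H x^-1; beware that the library's h ^ x is x^-1 * (h * x) *)
Definition lconj x H : set G := [set x * h * x^-1 | h in H].

Definition lcosets H K : set (set G) := lcoset K @` H.

(* [H : K], to be used when lcosets H K is finite *)
Definition gindex H K : nat := #|` fset_set (lcosets H K)|%fset.

Definition hecke_pair H :=
  subgroup H /\ forall x, finite_set (lcosets H (H `&` lconj x H)).

Definition reduced_hecke_pair H :=
  hecke_pair H /\ \bigcap_x lconj x H = [set 1].

(* The neighbourhood filter of x in the Hecke topology: it is generated by the
   left translates by x of the subbase at 1. *)
Definition hecke_nbhs H x : set_system G :=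
  filter_from (finI_from [set: G] (fun y => lcoset (lconj y H) x)) id.

End HeckePairs.

Section Completion.
Variables (G : groupType) (T : topologicalGroupType).

(* Cauchy for the two-sided uniformity. *)
Definition group_cauchy (F : set_system T) :=
  forall U, nbhs (1 : T) U ->
  exists2 A, F A & forall x y, A x -> A y -> U (x^-1 * y) /\ U (x * y^-1).

Definition group_complete :=
  forall F : set_system T, ProperFilter F -> group_cauchy F ->
  exists x : T, F --> x.

(* i exhibits T as the Hausdorff completion of G equipped with the Hecke
   topology of (G, H): T is complete, and i is a homomorphism onto a dense
   subgroup that induces the Hecke topology on G. *)
Record hecke_completion (H : set G) (i : {multiplicative G -> T}) : Prop := {
  hecke_completion_hausdorff : hausdorff_space T;
  hecke_completion_complete : group_complete;
  hecke_completion_dense : dense (range i);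
  hecke_completion_nbhs : forall x U,
    hecke_nbhs H x U <-> exists2 V, nbhs (i x) V & i @^-1` V `<=` U
}.

End Completion.

Section HeckeTriples.
Variables (R : realType) (G : groupType).
Implicit Types (H : set G) (sigma : G -> R[i]).

(* sigma is a function on H: its values outside H are irrelevant. *)
Record hecke_triple H sigma : Prop := {
  hecke_triple_pair : hecke_pair H;
  hecke_triple_morph : forall h k, H h -> H k ->
    sigma (h * k) = (sigma h * sigma k)%R;
  hecke_triple_unitary : forall h, H h -> `|sigma h|%R = 1%R;
  hecke_triple_finite : finite_set (sigma @` H)
}.

Definition char_ker H sigma : set G := [set h | H h /\ sigma h = 1%R].

Definition reduced_hecke_triple H sigma :=
  hecke_triple H sigma /\ reduced_hecke_pair (char_ker H sigma).

Definition compat_set H sigma : set G :=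
  [set x | forall h, (H `&` lconj x H) h -> sigma h = sigma (x^-1 * h * x)].

Definition hecke_algebra H sigma : set (G -> R[i]) :=
  [set f | (forall h k x, H h -> H k ->
              f (h * x * k) = (sigma h * f x * sigma k)%R)
           /\ finite_set [set dcoset H x | x in [set x | f x != 0%R]]].

(* For f and g in the Hecke algebra the summand depends only on the coset c,
   and it is nonzero for finitely many c only. *)
Definition hecke_conv H (f g : G -> R[i]) : G -> R[i] := fun x =>
  (\sum_(c \in lcosets [set: G] H)
     let y := xget (1 : G)%g c in f y * g (y^-1 * x)%g)%R.

Definition hecke_modular (K : set G) (x : G) : R :=
  ((gindex K (K `&` lconj x K))%:R / (gindex K (K `&` lconj x^-1%g K))%:R)%R.

Definition hecke_star (K : set G) (f : G -> R[i]) : G -> R[i] := fun x =>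
  ((hecke_modular K x^-1%g)%:C%C * (f x^-1%g)^*)%R.

End HeckeTriples.

(* Analysis on a subgroup L of T; L is to be open, so that its Borel sets are
   the Borel sets of T included in L, and functions on L are represented by
   their extensions by 0 to T. *)
Section Haar.
Variables (R : realType) (T : topologicalGroupType).

Definition borel := g_sigma_algebraType (@open T).

Implicit Types (L : set T) (mu : {measure set borel -> \bar R}).
Implicit Types (f g : T -> R[i]).

Record haar_measure L mu : Prop := {
  haar_invariant : forall x (A : set borel), L x -> measurable A -> A `<=` L ->
    mu [set (x * a : T) | a in (A : set T)] = mu A;
  haar_compact : forall K : set T, compact K -> K `<=` L -> (mu K < +oo)%E;
  haar_outer : forall A : set borel, measurable A -> A `<=` L ->
    mu A = ereal_inf [set mu U | U in [set U : set T |
             [/\ open U, A `<=` U & U `<=` L]]];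
  haar_inner : forall U : set T, open U -> U `<=` L ->
    mu U = ereal_sup [set mu K | K in [set K : set T |
             compact K /\ K `<=` U]];
  haar_neq0 : mu L <> 0%E
}.

Definition modular_function L mu (Delta : T -> R) :=
  forall x (A : set borel), L x -> measurable A -> A `<=` L ->
    mu [set (a * x : T) | a in (A : set T)] = ((Delta x)%:E * mu A)%E.

Definition Cc L : set (T -> R[i]) :=
  [set f | {within L, continuous (f : T -> R[i]^o)} /\
           exists K : set T, [/\ compact K, K `<=` L &
                               forall x, ~ K x -> f x = 0%R]].

Definition Cintegral L mu f : R[i] :=
  (Rintegral mu L (fun x => complex.Re (f x))
   +i* Rintegral mu L (fun x => complex.Im (f x)))%C.

Definition Cc_conv L mu f g : T -> R[i] := fun x =>
  Cintegral L mu (fun y => (f y * g (y^-1 * x)%g)%R).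

Definition Cc_star (Delta : T -> R) f : T -> R[i] := fun x =>
  ((Delta x^-1%g)%:C%C * (f x^-1%g)^*)%R.

Definition char_proj (H : set T) (sigma : T -> R[i]) : T -> R[i] := fun x =>
  (\1_H x * sigma x)%R.

Definition Cc_corner L mu (p : T -> R[i]) : set (T -> R[i]) :=
  [set Cc_conv L mu (Cc_conv L mu p f) p | f in Cc L].

(* The continuous extension of a character sigma on H to the closure of the
   image of H; by density its values there are unique. *)
Definition continuous_extension (G : groupType) (i : G -> T) (H : set G)
    (sigma : G -> R[i]) (sigma' : T -> R[i]) :=
  {within closure (i @` H), continuous (sigma' : T -> R[i]^o)} /\
  forall h, H h -> sigma' (i h) = sigma h.

End Haar.

Section StarAlgebras.
Variable C : numClosedFieldType.

(* A is the underlying set of functions of a *-algebra with operations mul and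
   star; the values of mul and star outside A are irrelevant. *)
Definition star_closed (X : Type) (A : set (X -> C))
    (mul : (X -> C) -> (X -> C) -> X -> C) (star : (X -> C) -> X -> C) :=
  [/\ A (fun=> 0%R),
      forall (a : C) f g, A f -> A g -> A (fun x => a * f x + g x)%R,
      forall f g, A f -> A g -> A (mul f g) &
      forall f, A f -> A (star f)].

Definition star_isomorphic (X Y : Type)
    (A : set (X -> C)) mulA starA (B : set (Y -> C)) mulB starB :=
  [/\ star_closed A mulA starA, star_closed B mulB starB &
      exists Phi : (X -> C) -> (Y -> C),
        [/\ set_bij A B Phi,
            forall (a : C) f g, A f -> A g ->
              Phi (fun x => a * f x + g x)%R
              = (fun y => a * Phi f y + Phi g y)%R,
            forall f g, A f -> A g -> Phi (mulA f g) = mulB (Phi f) (Phi g) &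
            forall f, A f -> Phi (starA f) = starB (Phi f)]].

End StarAlgebras.

(* Main.v *)
(* Both algebras are compared with the functions F on the completion Gs that
   satisfy F (h x k) = sigma h * F x * sigma k on Hs and have compact support in
   Bs. Let Ks be the closure of K = ker sigma. It is a compact open subgroup
   with trace K on G, and G is dense, so every element of Gs lies in i x Ks for
   some x in G; hence sigmas, Bs and the functions F are determined by their
   restrictions to G. Restriction identifies the functions F with the Hecke
   algebra: a function in the Hecke algebra vanishes outside B, and its support
   is a finite union of double cosets, while a compact subset of Gs meets
   finitely many cosets of Ks. Since mu Hs = 1, the function p is a two-sided
   unit for the F, and p * f * p is such an F for every f in Cc Bs; thus the F
   form the corner. For two such functions the integrand of the convolution is
   constant on the left cosets of Hs, each of measure 1, which gives the sum
   defining the product of the Hecke algebra; and Delta (i x) is the quotient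
   of the indices in hecke_modular, because Ks is the disjoint union of
   [K : K n y K y^-1] translates of Ks n (i y) Ks (i y)^-1 and, for y = x and
   y = x^-1, the latter are exchanged by conjugation. *)
Require Import Defs.
From HB Require Import structures.
From mathcomp Require Import all_boot all_order all_algebra.
From mathcomp Require Import all_classical all_reals all_analysis.
From mathcomp Require Import measurable_realfun finmap complex.
Import Order.TTheory GRing.Theory Num.Theory numFieldNormedType.Exports.

Set Implicit Arguments.
Unset Strict Implicit.
Unset Printing Implicit Defensive.

Local Open Scope classical_set_scope.
Local Open Scope complex_scope.
Local Open Scope ring_scope.

(** * Subgroups and topological groups *)

Lemma subgroupE (G : groupType) (H : set G) : subgroup H <->
  H 1%g /\ forall x y, H x -> H y -> H (x * y^-1)%g.
Proof.
split=> -[H1 HD]; split; first exact: set_mem.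
- move=> x y Hx Hy.
  by apply: set_mem; apply: (HD x y); exact: mem_set.
- exact: mem_set.
- by move=> x y /set_mem Hx /set_mem Hy; apply: mem_set; exact: HD.
Qed.

Section Subgroup.
Variables (G : groupType) (H : set G).
Hypothesis HG : subgroup H.

Lemma subgroup1 : H 1%g.
Proof. by case/subgroupE: HG. Qed.

Lemma subgroupV x : H x -> H x^-1%g.
Proof.
by case/subgroupE: HG => H1 HD Hx; rewrite -[X in H X]mul1g; exact: HD.
Qed.

Lemma subgroupM x y : H x -> H y -> H (x * y)%g.
Proof.
case/subgroupE: HG => _ HD Hx Hy; rewrite -[y]invgK.
by apply: HD => //; exact: subgroupV.
Qed.

Lemma subgroupMl x y : H x -> H (x * y)%g = H y.
Proof.
move=> Hx; apply/propext; split; last exact: subgroupM.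
by move=> Hxy; rewrite -(mulKg x y); apply: subgroupM => //; exact: subgroupV.
Qed.

Lemma subgroupMr x y : H y -> H (x * y)%g = H x.
Proof.
move=> Hy; apply/propext; split=> [Hxy|Hx]; last exact: subgroupM.
by rewrite -(mulgK y x); apply: subgroupM => //; exact: subgroupV.
Qed.

Lemma subgroupVE x : H x^-1%g = H x.
Proof.
by apply/propext; split=> [/subgroupV|]; [rewrite invgK | exact: subgroupV].
Qed.

End Subgroup.

Definition gsimp (G : groupType) := (@mulgA G, @mul1g G, @mulg1 G, @invg1 G,
  @invgK G, @mulVg G, @mulgV G, @mulgK G, @mulgVK G, @invgM G).

Section MultiplicativeGroups.
Variables (G T : groupType) (i : {multiplicative G -> T}).

Lemma multiplicative1 : i 1%g = 1%g.
Proof. by apply: (@mulgI _ (i 1%g)); rewrite -gmulfM !mulg1. Qed.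

Lemma multiplicativeV x : i x^-1%g = (i x)^-1%g.
Proof.
by apply: (@mulgI _ (i x)); rewrite -gmulfM !mulgV multiplicative1.
Qed.

End MultiplicativeGroups.

Section TopologicalGroups.
Variable T : topologicalGroupType.
Implicit Types (x y : T) (A U : set T).

Lemma lmulg_continuous x : continuous (fun y : T => x * y)%g.
Proof.
move=> y; apply: (cvg_comp2 (F := nbhs y) (f := fun=> x) (g := id)
  (h := fun a b : T => (a * b)%g) (cvg_cst x) cvg_id).
exact: (@mulg_continuous T (x, y)).
Qed.
Lemma rmulg_continuous x : continuous (fun y : T => y * x)%g.
Proof.
move=> y; apply: (cvg_comp2 (F := nbhs y) (f := id) (g := fun=> x)
  (h := fun a b : T => (a * b)%g) cvg_id (cvg_cst x)).
exact: (@mulg_continuous T (y, x)).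
Qed.
Lemma divg_continuous : continuous (fun z : T * T => z.1 * z.2^-1)%g.
Proof.
move=> -[x y].
apply: (cvg_comp2 (F := nbhs (x, y)) (G := nbhs x) (H := nbhs y^-1%g)
  (f := fst) (g := fun z => z.2^-1%g) (h := fun a b : T => (a * b)%g) cvg_fst).
  apply: (@cvg_comp _ _ _ snd (fun z : T => z^-1%g) _ (nbhs y)).
    exact: cvg_snd.
  exact: (@invg_continuous T y).
exact: (@mulg_continuous T (x, y^-1)%g).
Qed.

Lemma open_lmulg x A : open A -> open [set y | A (x * y)%g].
Proof. by move=> oA; apply: open_comp => // y _; exact: lmulg_continuous. Qed.

Lemma open_rmulg x A : open A -> open [set y | A (y * x)%g].
Proof. by move=> oA; apply: open_comp => // y _; exact: rmulg_continuous. Qed.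

Lemma open_invg A : open A -> open [set y | A y^-1%g].
Proof. by move=> oA; apply: open_comp => // y _; exact: invg_continuous. Qed.

Lemma nbhs_divg x y U : nbhs (x * y^-1)%g U ->
  exists V W, [/\ nbhs x V, nbhs y W & forall v w, V v -> W w -> U (v * w^-1)%g].
Proof.
move=> /(@divg_continuous (x, y)) [[V W] /= [Vx Wy] VW]; exists V, W; split=> //.
by move=> v w Vv Ww; exact: (VW (v, w)).
Qed.

Lemma closure_subgroup A : subgroup A -> subgroup (closure A).
Proof.
move=> sA; apply/subgroupE; split; first by apply: subset_closure; exact: subgroup1.
move=> x y Ax Ay U /nbhs_divg[V [W [/Ax[v [Av Vv]] /Ay[w [Aw Ww]] VW]]].
exists (v * w^-1)%g; split; [exact: (proj2 (proj1 (subgroupE A) sA)) | exact: VW].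
Qed.

Lemma nbhs1_subgroup_open A : subgroup A -> nbhs (1 : T)%g A -> open A.
Proof.
move=> sA A1; rewrite openE => x Ax; rewrite /interior.
have : nbhs x [set y | A (x^-1 * y)%g].
  by apply: (@lmulg_continuous x^-1%g x); rewrite mulVg.
by apply: filterS => y /=; rewrite (subgroupMl sA) //; exact: subgroupV.
Qed.

Lemma compact_mulg A B : compact A -> compact B ->
  compact [set (x * y)%g | x in A & y in B].
Proof.
move=> cA cB.
have -> : [set (x * y)%g | x in A & y in B] =
    (fun z : T * T => z.1 * z.2)%g @` (A `*` B).
  apply/seteqP; split=> t; first by case=> x Ax [y By <-]; exists (x, y).
  by case=> -[x y] [Ax By] <-; exists x => //; exists y.
apply: continuous_compact; last exact: compact_setX.
by apply: continuous_subspaceT; exact: mulg_continuous.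
Qed.

Lemma compact_invg A : compact A -> compact [set x^-1%g | x in A].
Proof.
move=> cA; apply: continuous_compact => //.
by apply: continuous_subspaceT; exact: invg_continuous.
Qed.

End TopologicalGroups.

(** Induction on the list: an ultrafilter contains the first set or its complement.
    [completion_compact] uses this to pick one coset out of a finite cover. *)
Lemma ultra_seq_cover (S : Type) (I : eqType) (F : set_system S) (D : seq I)
    (A : I -> set S) : UltraFilter F ->
  F [set t | exists2 d, d \in D & A d t] -> exists d, F (A d).
Proof.
move=> uF; elim: D => [F0|d D IH Fd].
  exfalso; apply: (@filter_not_empty _ F).
  by apply: filterS F0 => t [].
have [|FC] := in_ultra_setVsetC (A d) uF; first by exists d.
apply: IH; apply: filterS2 FC Fd => t nA [e]; rewrite inE => /orP[/eqP ->|eD] //.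
by exists e.
Qed.

(** * Completion in the Hecke topology *)

Section HeckeCompletion.
Variables (G : groupType) (T : topologicalGroupType).
Variables (i : {multiplicative G -> T}) (K : set G).
Hypothesis KG : subgroup K.
Hypothesis iT : hecke_completion K i.

Let Ks : set T := closure (i @` K).

Lemma multiplicative_image_subgroup (H : set G) :
  subgroup H -> subgroup (i @` H).
Proof.
move=> HG; apply/subgroupE; split.
  by exists 1%g; [exact: subgroup1 | exact: multiplicative1].
move=> _ _ [x Hx <-] [y Hy <-]; exists (x * y^-1)%g.
  exact: (proj2 (proj1 (subgroupE H) HG)).
by rewrite gmulfM multiplicativeV.
Qed.

Lemma completion_meet_range (U : set T) t : open U -> U t -> exists x, U (i x).
Proof.
move=> oU Ut; have [|u [Uu [x _ xu]]] := hecke_completion_dense iT _ oU.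
  by exists t.
by exists x; rewrite xu.
Qed.

Lemma closure_image_subgroup : subgroup Ks.
Proof. by apply: closure_subgroup; exact: multiplicative_image_subgroup. Qed.

Lemma hecke_nbhs_lcoset x : hecke_nbhs K x (lcoset K x).
Proof.
(* The subbasic set of index 1 is already the coset [x K]. *)
exists (lcoset K x) => //; exists [fset (1 : G)%g]%fset.
  by move=> y _; exact: mem_set.
apply/seteqP; split=> [t|_ [k Kk <-] y /=].
  have e1 : (1%g : G) \in [fset (1 : G)%g]%fset by rewrite in_fset1.
  move=> /(_ _ e1) [_ [k Kk <-] <-]; exists k => //.
  by rewrite !gsimp.
rewrite in_fset1 => /eqP ->; exists k => //.
by exists k => //; rewrite !gsimp.
Qed.

(** An open neighbourhood of 1 whose trace on [G] lies in [K] is contained in [Ks]: by density,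
    every neighbourhood of one of its points contains some [i x] that also lies in it, and then [x]
    is in [K]. *)
Lemma completion_subgroup_open : open Ks.
Proof.
apply: nbhs1_subgroup_open; first exact: closure_image_subgroup.
have [V V1 VK] := (proj1 (hecke_completion_nbhs iT 1%g _))
  (hecke_nbhs_lcoset 1%g).
rewrite multiplicative1 in V1; rewrite nbhsE in V1.
case: V1 => W [oW W1] WV; rewrite nbhsE; exists W => // t Wt B.
rewrite nbhsE => -[B' [oB' B't] B'B].
have [|x [Bx Wx]] := completion_meet_range (openI oB' oW) (t := t); first by split.
exists (i x); split; last exact: B'B.
have [k Kk <-] : lcoset K 1%g x by apply: VK; exact: WV.
by exists k => //; rewrite mul1g.
Qed.

(** The coset [x K] is a neighbourhood of [x] in the Hecke topology, so if [i x] adheres to the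
    image of [K], then [x K] meets [K]. *)
Lemma completion_preim_subgroup x : Ks (i x) = K x.
Proof.
apply/propext; split=> [Kx|Kx]; last by apply: subset_closure; exists x.
have [V Vx VK] := (proj1 (hecke_completion_nbhs iT x _)) (hecke_nbhs_lcoset x).
have [_ [[k Kk <-] Vk]] := Kx _ Vx.
have [k' Kk' xk'] := VK _ Vk.
by rewrite -(subgroupMr KG x Kk') xk'.
Qed.

Lemma completion_conj_open y :
  open [set t | Ks ((i y)^-1 * t * i y)%g].
Proof.
apply: (@open_lmulg _ (i y)^-1%g [set t | Ks (t * i y)%g]).
by apply: open_rmulg; exact: completion_subgroup_open.
Qed.

Lemma completion_conjs_open (D : seq G) :
  open [set t | forall y, y \in D -> Ks ((i y)^-1 * t * i y)%g].
Proof.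
elim: D => [|d D IH].
  by rewrite (_ : [set t | _] = setT) ?predeqE//; exact: openT.
rewrite (_ : [set t | _] = [set t | Ks ((i d)^-1 * t * i d)%g] `&`
    [set t | forall y, y \in D -> Ks ((i y)^-1 * t * i y)%g]).
  by apply: openI => //; exact: completion_conj_open.
apply/seteqP; split=> t /=.
  by move=> H; split=> [|y yD]; apply: H; rewrite inE ?eqxx ?yD ?orbT.
by move=> [Hd H] y; rewrite inE => /orP[/eqP ->|/H].
Qed.

(* The closure of y K y^-1 is the set of t with (i y)^-1 t i y in Ks. *)
Lemma completion_nbhs1_conj U : nbhs (1 : T)%g U ->
  exists D : seq G,
    forall t, (forall y, y \in D -> Ks ((i y)^-1 * t * i y)%g) -> U t.
Proof.
rewrite -[X in nbhs X](mulgV (1%g : T)) => /nbhs_divg[V [W [V1 W1 VW]]].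
have [|D0 [D _ <-] DV] := (proj2 (hecke_completion_nbhs iT 1%g (i @^-1` V))).
  by exists V => //; rewrite multiplicative1.
exists D => t Dt.
move: W1; rewrite nbhsE => -[W' [oW' W'1] W'W].
(* By density some [i x] satisfies the same conditions as [t] with [t^-1 * i x] in [W']; this makes
   [t] the quotient of a point of [V] by a point of [W]. *)
have [|x [xD xW]] := completion_meet_range
    (openI (completion_conjs_open D) (open_lmulg t^-1%g oW')) (t := t).
  by split => //=; rewrite !gsimp.
have -> : t = (i x * (t^-1 * i x)^-1)%g by rewrite !gsimp.
apply: VW; last exact: W'W.
apply: DV => y /= /xD; rewrite -multiplicativeV -!gmulfM.
rewrite completion_preim_subgroup => Ky.
exists x; last by rewrite mul1g.
by exists (y^-1 * x * y)%g => //; rewrite !gsimp.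
Qed.

(* An ultrafilter on S contains a coset of each closure of y K y^-1, hence is
   Cauchy. *)
Lemma completion_compact (S : set T) : closed S ->
  (forall t, S t -> S t^-1%g) ->
  (forall y, exists D : seq T, forall t, S t ->
     exists2 d, d \in D & Ks ((i y)^-1 * (d^-1 * t) * i y)%g) ->
  compact S.
Proof.
move=> cS SV SD; rewrite compact_ultra => F uF FS.
have Fl y : exists d, F [set t | Ks ((i y)^-1 * (d^-1 * t) * i y)%g].
  have [D DS] := SD y; apply: (ultra_seq_cover (D := D)).
  by apply: filterS FS => t /DS.
(* [group_cauchy] is two-sided. Since [S] is stable under inverses, the covers apply to [t^-1] as
   well, which controls the quotients [x * y^-1]. *)
have Fr y : exists d, F [set t | Ks ((i y)^-1 * (d^-1 * t^-1) * i y)%g].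
  have [D DS] := SD y; apply: (ultra_seq_cover (D := D)
    (A := fun d => [set t | Ks ((i y)^-1 * (d^-1 * t^-1) * i y)%g])).
  by apply: filterS FS => t /SV /DS.
have [l lF] := choice Fl; have [r rF] := choice Fr.
have [|p Fp] := hecke_completion_complete iT (F := F) _.
  move=> U /completion_nbhs1_conj[D DU].
  exists (\bigcap_(y in [set` [fset y in D]%fset])
      ([set t | Ks ((i y)^-1 * ((l y)^-1 * t) * i y)%g] `&`
       [set t | Ks ((i y)^-1 * ((r y)^-1 * t^-1) * i y)%g])).
    by apply: filter_bigI => y _; apply: filterI.
  move=> a b Ha Hb; split; apply: DU => y yD.
    have {}yD : [set` [fset y in D]%fset] y by rewrite /= inE.
    have [Ha1 _] := Ha y yD; have [Hb1 _] := Hb y yD.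
    have := subgroupM closure_image_subgroup
      (subgroupV closure_image_subgroup Ha1) Hb1.
    by rewrite !gsimp.
  have {}yD : [set` [fset y in D]%fset] y by rewrite /= inE.
  have [_ Ha1] := Ha y yD; have [_ Hb1] := Hb y yD.
  have := subgroupM closure_image_subgroup
    (subgroupV closure_image_subgroup Ha1) Hb1.
  by rewrite !gsimp.
exists p; split => //; apply: cS => B pB.
by apply: (@filter_ex _ F); apply: filterI => //; exact: Fp.
Qed.

End HeckeCompletion.

(** * Schlichting completion of a Hecke triple *)

Lemma lconjE (G : groupType) (H : set G) x t : lconj x H t = H (x^-1 * t * x)%g.
Proof.
apply/propext; split=> [[h Hh <-]|Ht]; first by rewrite !gsimp.
by exists (x^-1 * t * x)%g => //; rewrite !gsimp.
Qed.

Lemma compat_setE (R : realType) (G : groupType) (H : set G) (sigma : G -> R[i])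
    x : compat_set H sigma x <->
  forall h, H h -> H (x^-1 * h * x)%g -> sigma h = sigma (x^-1 * h * x)%g.
Proof.
split=> [Bx h Hh Hxh|Bx h [Hh]]; last by rewrite lconjE; exact: Bx.
by apply: Bx; split=> //; rewrite lconjE.
Qed.

Section HeckeTriple.
Variables (R : realType) (G : groupType) (H : set G) (sigma : G -> R[i]).
Hypothesis Hsigma : reduced_hecke_triple H sigma.

Let K := char_ker H sigma.

Lemma hecke_triple_subgroup : subgroup H.
Proof. by case: Hsigma => -[[]]. Qed.

Lemma char_ker_subgroup : subgroup K.
Proof. by case: Hsigma => _ [[]]. Qed.

Let HG := hecke_triple_subgroup.
Let KG := char_ker_subgroup.

Lemma characterM h k : H h -> H k -> sigma (h * k)%g = sigma h * sigma k.
Proof. by case: Hsigma => -[_ + _ _] _; exact. Qed.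

Lemma character_norm h : H h -> `|sigma h| = 1.
Proof. by case: Hsigma => -[_ _ + _] _; exact. Qed.

Lemma character_neq0 h : H h -> sigma h != 0.
Proof. by move=> /character_norm sh; rewrite -normr_eq0 sh oner_eq0. Qed.

Lemma character1 : sigma 1%g = 1.
Proof. by case: (subgroup1 KG). Qed.

Lemma characterV h : H h -> sigma h^-1%g = (sigma h)^-1.
Proof.
move=> Hh; apply: (mulfI (character_neq0 Hh)).
rewrite divff ?character_neq0 // -characterM ?mulgV ?character1 //.
exact: (subgroupV HG).
Qed.

(* sigma embeds H / K into its finite range. *)
Lemma character_cosets : exists D : seq G,
  forall h, H h -> exists2 d, d \in D & K (d^-1 * h)%g.
Proof.
have /finite_seqP[z Hz] : finite_set (sigma @` H) by case: Hsigma => -[].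
exists [seq xget 1%g [set d | H d /\ sigma d = c] | c <- z] => h Hh.
set P := [set d | H d /\ sigma d = sigma h].
have [Hd dh] : P (xget 1%g P) by apply: xgetPex; exists h.
exists (xget 1%g P).
  apply/mapP; exists (sigma h) => //.
  by have : [set` z] (sigma h) by rewrite -Hz; exists h.
have HdV := subgroupV HG Hd.
split; first exact: subgroupM.
by rewrite characterM // characterV // dh mulVf ?character_neq0.
Qed.

Lemma char_ker_cosets y : exists D : seq G,
  forall k, K k -> exists2 d, d \in D &
    K (d^-1 * k)%g /\ K (y^-1 * (d^-1 * k) * y)%g.
Proof.
have /finite_seqP[z Kz] : finite_set (lcosets K (K `&` lconj y K)).
  by case: Hsigma => _ [[_ +] _]; exact.
exists [seq xget 1%g c | c <- z] => k Kk.
set P := lcoset (K `&` lconj y K) k.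
have [h [Kh yKh] hP] : P (xget 1%g P).
  apply: xgetPex; exists k; exists 1%g; last by rewrite mulg1.
  by split; rewrite ?lconjE ?mulg1 ?mulVg; exact: subgroup1.
exists (xget 1%g P).
  apply/mapP; exists P => //.
  by have : [set` z] P by rewrite -Kz; exists k.
(* The representative is [d = k * h] with [h] in both [K] and its conjugate, so [d^-1 * k] is
   [h^-1]. *)
rewrite -hP !gsimp; split; first exact: subgroupV.
by move: yKh; rewrite lconjE => /(subgroupV KG); rewrite !gsimp.
Qed.

Variables (T : topologicalGroupType) (i : {multiplicative G -> T}).
Hypothesis iT : hecke_completion K i.
Variable s : T -> R[i].
Hypothesis s_ext : continuous_extension i H sigma s.

Let Ks : set T := closure (i @` K).
Let Hs : set T := closure (i @` H).

Let KsG : subgroup Ks := closure_image_subgroup i KG.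
Let HsG : subgroup Hs := closure_image_subgroup i HG.
Let oKs : open Ks := completion_subgroup_open KG iT.
Let KsE x : Ks (i x) = K x := completion_preim_subgroup KG iT x.

Lemma completion_approx (U : set T) t : open U -> U 1%g ->
  exists x, U ((i x)^-1 * t)%g.
Proof.
move=> oU U1; have [|x Ux] := completion_meet_range iT
  (open_invg (open_rmulg t oU)) (t := t); first by rewrite /= mulVg.
by exists x.
Qed.

Lemma completion_coset t : exists x, Ks ((i x)^-1 * t)%g.
Proof. by apply: completion_approx => //; exact: subgroup1. Qed.

Lemma char_ker_closure_sub : Ks `<=` Hs.
Proof. by apply: closure_subset => _ [x [Hx _] <-]; exists x. Qed.

Lemma completion_closure_open : open Hs.
Proof.
apply: nbhs1_subgroup_open => //; apply: filterS char_ker_closure_sub _.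
by apply: open_nbhs_nbhs; split => //; exact: subgroup1.
Qed.

(** The neighbourhood [i x * Ks] of [i x] meets the image of [H], and points of [G] in it differ
    from [x] by an element of [K], hence of [H]. *)
Lemma completion_preim x : Hs (i x) = H x.
Proof.
apply/propext; split=> [Hx|Hx]; last by apply: subset_closure; exists x.
have [_ [[h Hh <-] Kh]] : (i @` H) `&` [set u | Ks ((i x)^-1 * u)%g] !=set0.
  apply: Hx; apply: open_nbhs_nbhs; split; first exact: open_lmulg.
  by rewrite /= mulVg; exact: subgroup1.
move: Kh; rewrite /= -multiplicativeV -gmulfM KsE.
by case; rewrite (subgroupMr HG) // (subgroupVE HG).
Qed.

Lemma completion_cosetE x t : Ks ((i x)^-1 * t)%g -> Hs t = H x.
Proof.
move=> Kt; rewrite -completion_preim.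
rewrite -(subgroupMr HsG (i x) (char_ker_closure_sub Kt)).
by rewrite !gsimp.
Qed.

(** This reduces values of [s] to values of [sigma]. If [s t] were not [sigma x], continuity would
    keep [s] away from [sigma x] near [t]; but there density gives a point [i g] with [g] in [x K],
    where [s] takes the value [sigma x]. *)
Lemma extensionE x t : Hs t -> Ks ((i x)^-1 * t)%g -> s t = sigma x.
Proof.
move=> Ht Kt.
have Hx : H x by rewrite -(completion_cosetE Kt).
have [s_cont sE] := s_ext.
rewrite (continuous_open_subspace _ completion_closure_open) in s_cont.
have {}s_cont := s_cont t (mem_set Ht).
apply: contrapT => /eqP sx.
have oC : open (~` [set (sigma x : R[i]^o)]).
  apply: closed_openC; apply: accessible_closed_set1.
  by apply: hausdorff_accessible; exact: norm_hausdorff.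
have st : nbhs t [set u | s u <> sigma x].
  apply: (s_cont (~` [set sigma x])); apply: open_nbhs_nbhs.
  by split => //; exact/eqP.
have : nbhs t [set u | Ks ((i x)^-1 * u)%g].
  by apply: open_nbhs_nbhs; split => //; exact: open_lmulg.
move=> /(filterI st); rewrite nbhsE => -[V [oV Vt] VsK].
have [g Vg] := completion_meet_range iT oV Vt.
have [/= + Kg] := VsK _ Vg; apply.
move: Kg; rewrite -multiplicativeV -gmulfM KsE.
move=> [Hg sg].
have {}Hg : H g by move: Hg; rewrite (subgroupMl HG) // (subgroupVE HG).
rewrite sE // -(mulVKg x g) characterM ?sg ?mulr1 //.
by rewrite (subgroupMl HG) // (subgroupVE HG).
Qed.

(** [Ks] need not be normal, so the order of approximation matters: first [y] for [k], then [x] for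
    [h] with an error that stays in [Ks] after conjugation by [i y]. Then [x * y] approximates
    [h * k]. *)
Lemma extensionM h k : Hs h -> Hs k -> s (h * k)%g = s h * s k.
Proof.
move=> Hh Hk; have [y Ky] := completion_coset k.
have [|x [/= Kx Kyx]] := completion_approx h
  (openI oKs (completion_conj_open KG iT y)).
  by split; rewrite /= ?mulg1 ?mulVg; exact: (subgroup1 KsG).
rewrite (extensionE Hh Kx) (extensionE Hk Ky) -characterM.
- apply: extensionE; first exact: (subgroupM HsG).
  have := subgroupM KsG Kyx Ky; rewrite gmulfM.
  by rewrite !gsimp.
- by rewrite -(completion_cosetE Kx).
- by rewrite -(completion_cosetE Ky).
Qed.

Lemma extension_norm h : Hs h -> `|s h| = 1.
Proof.
move=> Hh; have [x Kx] := completion_coset h.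
by rewrite (extensionE Hh Kx) character_norm // -(completion_cosetE Kx).
Qed.

Lemma extension_neq0 h : Hs h -> s h != 0.
Proof. by move=> /extension_norm sh; rewrite -normr_eq0 sh oner_eq0. Qed.

Lemma extension1 : s 1%g = 1.
Proof.
have [_ sE] := s_ext.
by rewrite -(multiplicative1 i) sE ?character1 //; exact: subgroup1.
Qed.

Lemma extensionV h : Hs h -> s h^-1%g = (s h)^-1.
Proof.
move=> Hh; apply: (mulfI (extension_neq0 Hh)).
rewrite divff ?extension_neq0 // -extensionM ?mulgV ?extension1 //.
exact: (subgroupV HsG).
Qed.

Lemma extension_ker k : Ks k -> s k = 1.
Proof.
move=> Kk; rewrite -character1; apply: extensionE.
  exact: char_ker_closure_sub.
by rewrite multiplicative1 !gsimp.
Qed.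

Lemma completion_closure_compact : compact Hs.
Proof.
apply: (completion_compact KG iT); first exact: closed_closure.
  by move=> t Ht; exact: (subgroupV HsG).
move=> y; have [D DH] := character_cosets; have [E EK] := char_ker_cosets y.
(* Here [d] represents the cosets of [K] in [H], and [e] those of [K] intersected with [y K y^-1] in
   [K]; the products [d * e] represent the cosets of this intersection in [H]. *)
exists [seq i (d * e)%g | d <- D, e <- E] => t Ht.
have [|x [/= Kx Kyx]] := completion_approx t
  (openI oKs (completion_conj_open KG iT y)).
  by split; rewrite /= ?mulg1 ?mulVg; exact: (subgroup1 KsG).
have Hx : H x by rewrite -(completion_cosetE Kx).
have [d dD Kd] := DH x Hx; have [e eE [Ke Kye]] := EK _ Kd.
exists (i (d * e)%g); first exact: allpairs_f.
have : Ks (i (y^-1 * (e^-1 * (d^-1 * x)) * y)%g).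
  by rewrite KsE.
move=> /(subgroupM KsG) /(_ Kyx).
by rewrite !gmulfM !multiplicativeV !gsimp.
Qed.

Let B := compat_set H sigma.
Let Bs := compat_set Hs s.

(** A character with commuting values is invariant under conjugation: [s (k^-1 * u * k) = s u] for
    [u] and [k] in [Hs]. *)
Lemma completion_compatMr t k : Hs k -> Bs t -> Bs (t * k)%g.
Proof.
move=> Hk /compat_setE Bt; apply/compat_setE => h Hh.
have -> : ((t * k)^-1 * h * (t * k) = k^-1 * (t^-1 * h * t) * k)%g.
  by rewrite !gsimp.
have HkV : Hs k^-1%g by exact: (subgroupV HsG).
rewrite (subgroupMr HsG) // (subgroupMl HsG) // => Ht.
have -> : s (k^-1 * (t^-1 * h * t) * k)%g = s (t^-1 * h * t)%g; last exact: Bt.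
have Hkt := subgroupM HsG HkV Ht.
rewrite (extensionM Hkt Hk).
by rewrite (extensionM HkV Ht) extensionV // mulrAC mulVf ?extension_neq0 ?mul1r.
Qed.

Lemma completion_compat_preim x : Bs (i x) = B x.
Proof.
have [_ sE] := s_ext.
apply/propext; split=> /compat_setE Bx; apply/compat_setE => h.
  move=> Hh Hxh; have := Bx (i h).
  rewrite -multiplicativeV -!gmulfM !completion_preim !sE //; exact.
(* One [g] serves for both sides of the identity: [g] approximates [h], and [x^-1 * g * x]
   approximates the conjugate of [h]. *)
move=> Hh Hxh; have [|g [/= Kg Kxg]] := completion_approx h
  (openI oKs (completion_conj_open KG iT x)).
  by split; rewrite /= ?mulg1 ?mulVg; exact: (subgroup1 KsG).
have {}Kxg : Ks ((i (x^-1 * g * x))^-1 * ((i x)^-1 * h * i x))%g.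
  by move: Kxg; rewrite !gmulfM !multiplicativeV !gsimp.
rewrite (extensionE Hh Kg) (extensionE Hxh Kxg); apply: Bx.
  by rewrite -(completion_cosetE Kg).
by rewrite -(completion_cosetE Kxg).
Qed.

Lemma completion_compat_cosetE x t : Ks ((i x)^-1 * t)%g -> Bs t = B x.
Proof.
move=> /char_ker_closure_sub Ht; rewrite -completion_compat_preim.
apply/propext; split=> Bt; last first.
  by have := completion_compatMr Ht Bt; rewrite !gsimp.
have /completion_compatMr : Hs ((i x)^-1 * t)^-1%g by exact: (subgroupV HsG).
by move=> /(_ _ Bt); rewrite !gsimp.
Qed.

Hypothesis BG : subgroup B.

Lemma completion_compat_subgroup : subgroup Bs.
Proof.
apply/subgroupE; split.
  by rewrite -(multiplicative1 i) completion_compat_preim; exact: subgroup1.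
move=> t u Bt Bu.
(* Inversion does not respect left cosets of [Ks], so [z] is chosen to approximate [u^-1] while
   [z^-1] approximates [u]. *)
have [|z [/= Kz Kzu]] := completion_meet_range iT
    (openI (open_invg (open_rmulg u^-1%g oKs)) (open_rmulg u oKs)) (t := u^-1%g).
  by split; rewrite /= ?invgK ?mulgV ?mulVg; exact: (subgroup1 KsG).
have Bz : B z.
  rewrite -(subgroupVE BG) -(@completion_compat_cosetE _ u) //.
  by rewrite multiplicativeV invgK.
have [|x [/= Kx Kxz]] := completion_approx t
  (openI oKs (completion_conj_open KG iT z)).
  by split; rewrite /= ?mulg1 ?mulVg; exact: (subgroup1 KsG).
rewrite (@completion_compat_cosetE (x * z)%g).
  by rewrite (subgroupMr BG) // -(completion_compat_cosetE Kx).
by have := subgroupM KsG Kxz Kz; rewrite gmulfM !gsimp.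
Qed.

Lemma completion_sub_compat : Hs `<=` Bs.
Proof.
move=> h Hh; rewrite -(mul1g h); apply: completion_compatMr => //.
exact: (subgroup1 completion_compat_subgroup).
Qed.

Lemma completion_compat_open : open Bs.
Proof.
apply: (nbhs1_subgroup_open completion_compat_subgroup).
apply: filterS completion_sub_compat _.
by apply: open_nbhs_nbhs; split; [exact: completion_closure_open | exact: subgroup1].
Qed.

End HeckeTriple.

(** * Integration on an open subgroup *)

Lemma open_measurable_borel (T : topologicalGroupType) (A : set T) :
  open A -> measurable (A : set (borel T)).
Proof. by move=> oA; apply: sub_sigma_algebra. Qed.

(** * Integration of complex-valued functions *)

Section ComplexIntegral.
Variables (R : realType) (T : topologicalGroupType) (L : set T).
Variable mu : {measure set (borel T) -> \bar R}.
Implicit Types (f g : T -> R[i]) (A : set T).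

Definition Cintegrable f :=
  mu.-integrable (L : set (borel T))
    (EFin \o (fun x : borel T => complex.Re (f x))) /\
  mu.-integrable (L : set (borel T))
    (EFin \o (fun x : borel T => complex.Im (f x))).

Lemma eq_Cintegral f g : (forall x, L x -> f x = g x) ->
  Cintegral L mu f = Cintegral L mu g.
Proof.
move=> fg; congr Complex; apply: eq_Rintegral => x /set_mem Lx;
  by rewrite fg.
Qed.

Hypothesis mL : measurable (L : set (borel T)).

Lemma CintegrableZ (a : R[i]) f : Cintegrable f -> Cintegrable (fun x => a * f x).
Proof.
case: a => a b [fr fi]; split.
  apply: (eq_integrable mL (fun x : borel T =>
     ((a%:E * (EFin \o (fun x : borel T => complex.Re (f x))) x) -
      (b%:E * (EFin \o (fun x : borel T => complex.Im (f x))) x))%E)).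
    by move=> x _ /=; case: (f x).
  by apply: integrableB => //; apply: integrableZl.
apply: (eq_integrable mL (fun x : borel T =>
   ((a%:E * (EFin \o (fun x : borel T => complex.Im (f x))) x) +
    (b%:E * (EFin \o (fun x : borel T => complex.Re (f x))) x))%E)).
  by move=> x _ /=; case: (f x).
by apply: integrableD => //; apply: integrableZl.
Qed.

Lemma CintegralZ (a : R[i]) f : Cintegrable f ->
  Cintegral L mu (fun x => a * f x) = a * Cintegral L mu f.
Proof.
case: a => a b [fr fi]; rewrite /Cintegral; congr Complex.
  rewrite (eq_Rintegral mu (g := fun x : borel T =>
    a * complex.Re (f x) - b * complex.Im (f x))).
    rewrite RintegralB //; last 2 first.
      exact: (integrableZl mL a fr).
    exact: (integrableZl mL b fi).
    by rewrite !RintegralZl.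
  by move=> x _ /=; case: (f x).
rewrite (eq_Rintegral mu (g := fun x : borel T =>
  a * complex.Im (f x) + b * complex.Re (f x))).
  rewrite RintegralD //; last 2 first.
    exact: (integrableZl mL a fi).
  exact: (integrableZl mL b fr).
  by rewrite !RintegralZl.
by move=> x _ /=; case: (f x).
Qed.

Lemma CintegrableD f g : Cintegrable f -> Cintegrable g ->
  Cintegrable (fun x => f x + g x).
Proof.
move=> [fr fi] [gr gi]; split.
  apply: (eq_integrable mL (fun x : borel T =>
     ((complex.Re (f x))%:E + (complex.Re (g x))%:E)%E)).
    by move=> x _ /=; case: (f x); case: (g x).
  exact: integrableD.
apply: (eq_integrable mL (fun x : borel T =>
   ((complex.Im (f x))%:E + (complex.Im (g x))%:E)%E)).
  by move=> x _ /=; case: (f x); case: (g x).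
exact: integrableD.
Qed.

Lemma CintegralD f g : Cintegrable f -> Cintegrable g ->
  Cintegral L mu (fun x => f x + g x) = Cintegral L mu f + Cintegral L mu g.
Proof.
move=> [fr fi] [gr gi]; rewrite /Cintegral; congr Complex.
  by rewrite -RintegralD //; apply: eq_Rintegral => x _; case: (f x); case: (g x).
by rewrite -RintegralD //; apply: eq_Rintegral => x _; case: (f x); case: (g x).
Qed.

Lemma Cintegrable0 : Cintegrable (fun=> 0).
Proof. by split; exact: integrable0. Qed.

Lemma Cintegral0 : Cintegral L mu (fun=> 0) = 0.
Proof.
rewrite -[RHS](mul0r (Cintegral L mu (fun=> 0))) -CintegralZ.
  by apply: eq_Cintegral => x _; rewrite mul0r.
exact: Cintegrable0.
Qed.

Let Re_indic A (x : T) : complex.Re (\1_A x : R[i]) = \1_A x.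
Proof. by rewrite !indicE; case: (_ \in _). Qed.

Let Im_indic A (x : T) : complex.Im (\1_A x : R[i]) = 0.
Proof. by rewrite !indicE; case: (_ \in _). Qed.

Lemma Cintegrable_indic A : open A -> A `<=` L -> (mu A < +oo)%E ->
  Cintegrable \1_A.
Proof.
move=> /open_measurable_borel mA AL Aoo; split; last first.
  apply: (eq_integrable mL (cst 0%E)) => [x _ /=|]; first by rewrite Im_indic.
  exact: integrable0.
apply: (eq_integrable mL (fun x : borel T => (\1_A x)%:E)).
  by move=> x _ /=; rewrite Re_indic.
apply/integrableP; split.
  by apply/measurable_EFinP; exact: measurable_indic.
rewrite (eq_integral (fun x : borel T => (\1_A x)%:E)).
  by rewrite integral_indic // setIidl.
by move=> x _; rewrite gee0_abs // lee_fin indicE.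
Qed.

Lemma Cintegral_indic A : open A -> A `<=` L ->
  Cintegral L mu \1_A = (fine (mu A))%:C.
Proof.
move=> /open_measurable_borel mA AL; rewrite /Cintegral; congr Complex.
  rewrite (eq_Rintegral mu (g := fun x : borel T => \1_A x)) => [|x _].
    by rewrite /Rintegral integral_indic // setIidl.
  exact: Re_indic.
rewrite (eq_Rintegral mu (g := fun x : borel T => 0)) => [|x _].
  by rewrite /Rintegral integral0.
exact: Im_indic.
Qed.

Lemma Cintegral_sum (I : eqType) (r : seq I) (v : I -> R[i]) (A : I -> set T) :
  (forall j, j \in r -> [/\ open (A j), A j `<=` L & mu (A j) = 1%E]) ->
  Cintegrable (fun x => \sum_(j <- r) v j * \1_(A j) x) /\
  Cintegral L mu (fun x => \sum_(j <- r) v j * \1_(A j) x) = \sum_(j <- r) v j.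
Proof.
elim: r => [_|j r IH rA].
  under [X in Cintegrable X]eq_fun do rewrite big_nil.
  under [X in Cintegral L mu X]eq_fun do rewrite big_nil.
  by rewrite big_nil Cintegral0; split => //; exact: Cintegrable0.
under [X in Cintegrable X]eq_fun do rewrite big_cons.
under [X in Cintegral L mu X]eq_fun do rewrite big_cons.
have [|IH1 IH2] := IH; first by move=> k kr; apply: rA; rewrite inE kr orbT.
have [oA AL A1] := rA j (mem_head _ _).
have Aj : Cintegrable \1_(A j).
  by apply: Cintegrable_indic => //; rewrite [X in (X < _)%E]A1 ltry.
split; first by apply: CintegrableD => //; exact: CintegrableZ.
rewrite CintegralD //; last exact: CintegrableZ.
by rewrite IH2 big_cons CintegralZ // Cintegral_indic // A1 /= mulr1.
Qed.

End ComplexIntegral.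

Section ComplexParts.
Variable R : realType.

Lemma Re_continuous : continuous (@complex.Re R : R[i]^o -> R).
Proof.
move=> z A /nbhs_ballP[e e0 eA]; exists e%:C; first by rewrite /= ltcR.
move=> w /= zw; apply: eA; rewrite /ball /=.
have -> : complex.Re z - complex.Re w = complex.Re (z - w) by case: (z); case: (w).
by rewrite -ltcR; apply: le_lt_trans zw; exact: normc_ge_Re.
Qed.

Lemma Im_continuous : continuous (@complex.Im R : R[i]^o -> R).
Proof.
move=> z A /nbhs_ballP[e e0 eA]; exists e%:C; first by rewrite /= ltcR.
move=> w /= zw; apply: eA; rewrite /ball /=.
(* Multiplication by [i] preserves the modulus, so the bound on real parts applies. *)
have -> : complex.Im z - complex.Im w = - complex.Re ((z - w) * 'i%C).
  by rewrite ReiNIm opprK; case: (z); case: (w).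
rewrite normrN -ltcR; apply: le_lt_trans zw; apply: le_trans (normc_ge_Re _) _.
rewrite normrM; have -> : `|('i%C : R[i])| = 1.
  rewrite normc_def /= (_ : 0 ^+ 2 + 1 ^+ 2 = 1 :> R) ?sqrtr1 //.
  by rewrite expr1n expr0n add0r.
by rewrite mulr1.
Qed.

End ComplexParts.

(** * Translation invariance and integrability *)

Section Translation.
Variables (R : realType) (T : topologicalGroupType) (L : set T).
Variable mu : {measure set (borel T) -> \bar R}.
Hypothesis LG : subgroup L.
Hypothesis oL : open L.
Hypothesis mu_haar : haar_measure L mu.

Let mL : measurable (L : set (borel T)) := open_measurable_borel oL.

Lemma haar_preim_lmulg (x : T) (U : set T) : L x -> open U -> U `<=` L ->
  mu [set y | U (x^-1 * y)%g] = mu U.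
Proof.
move=> Lx oU UL.
rewrite -(haar_invariant mu_haar Lx (open_measurable_borel oU) UL).
congr (mu _); apply/seteqP; split=> y /=.
  by move=> Uy; exists (x^-1 * y)%g; rewrite ?mulVKg.
by case=> u Uu <-; rewrite mulKg.
Qed.

Lemma lmulg_measurable (h : T) :
  measurable_fun [set: borel T] ((fun y => h * y)%g : borel T -> borel T).
Proof.
apply: (@measurability _ _ (borel T) (borel T) setT _ (@open T)) => // _ [A oA <-].
by rewrite setTI; apply: open_measurable_borel; exact: open_lmulg.
Qed.

(** Translation by [h] maps [L] onto itself and pushes [mu] forward to a measure that agrees with
    [mu] on the measurable subsets of [L]. *)
Lemma ge0_integral_lmulg (h : T) (f : borel T -> \bar R) : L h ->
  measurable_fun (L : set (borel T)) f -> (forall y, 0 <= f y)%E ->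
  (\int[mu]_(y in (L : set (borel T))) f (h * y)%g =
   \int[mu]_(y in (L : set (borel T))) f y)%E.
Proof.
move=> Lh mf f0.
have := ge0_integral_pushforward (lmulg_measurable h) mu mL mf
  (fun y _ => f0 y).
have -> : ((fun y => h * y)%g : borel T -> borel T) @^-1` L = L.
  by apply/seteqP; split=> y /=; rewrite (subgroupMl LG).
move=> <-; apply: eq_measure_integral => [|mh A mA AL].
  exact: lmulg_measurable.
rewrite /pushforward -(haar_invariant mu_haar (subgroupV LG Lh) mA AL).
congr (mu _); apply/seteqP; split=> y /=.
  by move=> Ay; exists (h * y)%g; rewrite ?mulKg.
by case=> a Aa <-; rewrite mulVKg.
Qed.

Lemma Rintegral_lmulg (h : T) (f : borel T -> R) : L h ->
  measurable_fun (L : set (borel T)) f ->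
  Rintegral mu (L : set (borel T)) (fun y : borel T => f (h * y)%g) =
  Rintegral mu (L : set (borel T)) f.
Proof.
move=> Lh /measurable_EFinP mf; rewrite /Rintegral; congr fine.
rewrite integralE [RHS]integralE; congr (_ - _)%E.
  rewrite -(ge0_integral_lmulg Lh (measurable_funepos mf) (funepos_ge0 _)).
  by apply: eq_integral => y _; rewrite !funeposE.
rewrite -(ge0_integral_lmulg Lh (measurable_funeneg mf) (funeneg_ge0 _)).
by apply: eq_integral => y _; rewrite !funenegE.
Qed.

Lemma Cintegral_lmulg (h : T) (f : T -> R[i]) : L h -> Cintegrable L mu f ->
  Cintegral L mu (fun y => f (h * y)%g) = Cintegral L mu f.
Proof.
move=> Lh [/measurable_int/measurable_EFinP mr /measurable_int/measurable_EFinP mi].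
rewrite /Cintegral; congr Complex.
  exact: (Rintegral_lmulg Lh mr).
exact: (Rintegral_lmulg Lh mi).
Qed.

Hypothesis hT : hausdorff_space T.

(** Extended by zero from [L] or from [C], [f] is the same function; on [C] it is bounded and the
    measure is finite. *)
Lemma compact_supp_integrable (f : T -> R) (C : set T) :
  {in L, continuous f} -> compact C -> C `<=` L -> (forall x, ~ C x -> f x = 0) ->
  mu.-integrable (L : set (borel T)) (EFin \o (f : borel T -> R)).
Proof.
move=> cf cC CL fC.
have mf : measurable_fun (L : set (borel T)) (f : borel T -> R).
  move=> _.
  apply: (measurability (RGenOpens.G (R := R)) (RGenOpens.measurableE R)) => //.
  move=> _ [_ [a [b ->] <-]]; apply: open_measurable_borel.
  move: cf; rewrite -(continuous_open_subspace f oL).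
  have oab : open `]a, b[%classic by exact: interval_open.
  move=> /continuousP/(_ _ oab).
  by move=> /open_subspaceP[V oV]; rewrite setIC [RHS]setIC => <-; exact: openI.
have mC : measurable (C : set (borel T)).
  rewrite -[X in measurable X]setCK; apply: measurableC.
  by apply: open_measurable_borel; apply: closed_openC; exact: compact_closed.
apply/(integrable_mkcond _ mL).
rewrite (_ : _ \_ _ = (EFin \o (f : borel T -> R)) \_ C).
  apply/(integrable_mkcond _ mC); apply: measurable_bounded_integrable => //.
  - exact: (haar_compact mu_haar).
  - exact: (measurable_funS mL CL).
  - have : compact (f @` C).
      apply: continuous_compact => //; apply: continuous_in_subspaceT => x.
      by move=> /set_mem/CL/mem_set; exact: cf.
    move=> /compact_bounded[M [Mr fM]]; exists M; split=> // N MN x Cx.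
    by apply: (fM N MN); exists x.
apply/funext => x; rewrite !patchE.
have [Cx|Cx] := pselect (C x).
  by rewrite (mem_set (CL _ Cx)) (mem_set Cx).
by rewrite (memNset Cx) /= fC //; case: ifP.
Qed.

Lemma Cc_integrable f : Cc L f -> Cintegrable L mu f.
Proof.
move=> [cf [C [cC CL fC]]].
rewrite (continuous_open_subspace _ oL) in cf.
split; apply: (compact_supp_integrable (C := C)) => //.
- by move=> x Lx; apply: (continuous_comp (cf x Lx)); exact: Re_continuous.
- by move=> x /fC ->.
- by move=> x Lx; apply: (continuous_comp (cf x Lx)); exact: Im_continuous.
- by move=> x /fC ->.
Qed.

End Translation.

(** * Convolution and compact supports *)

Section Convolution.
Variables (R : realType) (T : topologicalGroupType) (L : set T).
Variable mu : {measure set (borel T) -> \bar R}.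
Hypothesis LG : subgroup L.
Hypothesis oL : open L.
Hypothesis mu_haar : haar_measure L mu.
Hypothesis hT : hausdorff_space T.
Implicit Types (f g : T -> R[i]).

Let mL : measurable (L : set (borel T)) := open_measurable_borel oL.

Lemma Cc_notin f x : Cc L f -> ~ L x -> f x = 0.
Proof. by move=> [_ [C [_ CL fC]]] Lx; apply: fC => /CL. Qed.

Lemma Cc_conv_integrable f g x : Cc L f -> Cc L g ->
  Cintegrable L mu (fun y => f y * g (y^-1 * x)%g).
Proof.
(* For [x] outside [L], [y^-1 * x] is outside [L] for all [y] in [L], and the integrand is zero on
   [L]. *)
move=> cf cg; have [Lx|Lx] := pselect (L x); last first.
  have fg0 y : L y -> f y * g (y^-1 * x)%g = 0.
    move=> Ly; rewrite (Cc_notin cg) ?mulr0 //.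
    by rewrite (subgroupMl LG) //; exact: (subgroupV LG).
  split; apply: (eq_integrable mL (cst 0%E)) => [y /set_mem/fg0 /= -> //|];
    exact: integrable0.
apply: (Cc_integrable oL mu_haar hT).
have [cf1 [C [cC CL fC]]] := cf; have [cg1 _] := cg.
split; last by exists C; split=> // y /fC ->; rewrite mul0r.
rewrite (continuous_open_subspace _ oL) in cf1.
rewrite (continuous_open_subspace _ oL) in cg1.
rewrite (continuous_open_subspace _ oL) => y yL.
apply: (@cvgM _ _ _ _ (f : T -> R[i]^o) (fun y => g (y^-1 * x)%g : R[i]^o)).
  exact: cf1.
apply: (@continuous_comp _ _ _ (fun y => y^-1 * x)%g (g : T -> R[i]^o)).
  apply: (@continuous_comp _ _ _ (fun y => y^-1)%g (fun y : T => y * x)%g).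
    exact: invg_continuous.
  exact: rmulg_continuous.
apply: cg1; apply: mem_set; apply: (subgroupM LG) => //.
by apply: (subgroupV LG); exact: set_mem.
Qed.

(** Substitute [h * y] for [y] in the integral; in the second factor [h] cancels. *)
Lemma Cc_convMl f g h (c : R[i]) x : Cc L f -> Cc L g -> L h ->
  (forall y, f (h * y)%g = c * f y) ->
  Cc_conv L mu f g (h * x)%g = c * Cc_conv L mu f g x.
Proof.
move=> cf cg Lh fh; rewrite /Cc_conv.
rewrite -(Cintegral_lmulg LG oL mu_haar Lh); last exact: Cc_conv_integrable.
rewrite -(CintegralZ mL); last exact: Cc_conv_integrable.
by apply: eq_Cintegral => y _; rewrite fh mulrA !gsimp.
Qed.

Lemma Cc_convMr f g k (c : R[i]) x : Cc L f -> Cc L g ->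
  (forall y, g (y * k)%g = c * g y) ->
  Cc_conv L mu f g (x * k)%g = c * Cc_conv L mu f g x.
Proof.
move=> cf cg gk; rewrite /Cc_conv -(CintegralZ mL); last exact: Cc_conv_integrable.
by apply: eq_Cintegral => y _; rewrite mulgA gk mulrCA.
Qed.

Lemma Cc_conv_support f g (C D : set T) :
  (forall y, ~ C y -> f y = 0) -> (forall y, ~ D y -> g y = 0) ->
  forall x, ~ [set (y * z)%g | y in C & z in D] x -> Cc_conv L mu f g x = 0.
Proof.
move=> fC gD x xCD; rewrite -[RHS](Cintegral0 mu mL).
apply: eq_Cintegral => y _.
have [Cy|/fC ->] := pselect (C y); last by rewrite mul0r.
rewrite gD ?mulr0 // => Dyx; apply: xCD.
by exists y => //; exists (y^-1 * x)%g; rewrite ?mulVKg.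
Qed.

(** [f] is constant on [U * x], a neighbourhood of [x], hence continuous. *)
Lemma Cc_locally_constant f (U C : set T) : open U -> U 1%g ->
  (forall u x, U u -> f (u * x)%g = f x) ->
  compact C -> C `<=` L -> (forall x, ~ C x -> f x = 0) -> Cc L f.
Proof.
move=> oU U1 fU cC CL fC; split; last by exists C.
apply: continuous_subspaceT => x A Afx.
have : nbhs x [set y | U (y * x^-1)%g].
  apply: open_nbhs_nbhs; split; first exact: open_rmulg.
  by rewrite /= mulgV.
apply: filterS => y /= Uy; rewrite /= -(mulgVK x y) fU //.
exact: (nbhs_singleton Afx).
Qed.

End Convolution.

(** Continuity follows from equivariance when [s] is 1 on an open neighbourhood of 1, see
    [equivariant_Cc]. These functions turn out to be the corner ([Cc_cornerE]). *)
Definition Cc_equivariant (R : realType) (T : topologicalGroupType)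
    (L H : set T) (s : T -> R[i]) : set (T -> R[i]) :=
  [set f | (forall h k x, H h -> H k -> f (h * x * k)%g = s h * f x * s k) /\
           exists C : set T, [/\ compact C, C `<=` L & forall x, ~ C x -> f x = 0]].

(** * The corner of the convolution algebra *)

Section Corner.
Variables (R : realType) (T : topologicalGroupType) (L H K : set T).
Variables (s : T -> R[i]) (mu : {measure set (borel T) -> \bar R}).
Hypothesis hT : hausdorff_space T.
Hypothesis LG : subgroup L.
Hypothesis oL : open L.
Hypothesis HG : subgroup H.
Hypothesis oH : open H.
Hypothesis cH : compact H.
Hypothesis HL : H `<=` L.
Hypothesis oK : open K.
Hypothesis K1 : K 1%g.
Hypothesis KH : K `<=` H.
Hypothesis sM : forall h k, H h -> H k -> s (h * k)%g = s h * s k.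
Hypothesis s_norm : forall h, H h -> `|s h| = 1.
Hypothesis sK : forall k, K k -> s k = 1.
Hypothesis mu_haar : haar_measure L mu.
Hypothesis mu_H : mu H = 1%E.

Let mL : measurable (L : set (borel T)) := open_measurable_borel oL.
Let p := char_proj H s.
Let E := Cc_equivariant L H s.
Notation "f \* g" := (Cc_conv L mu f g) : ring_scope.

Let s_neq0 h : H h -> s h != 0.
Proof. by move=> /s_norm sh; rewrite -normr_eq0 sh oner_eq0. Qed.

Let sV h : H h -> s h^-1%g = (s h)^-1.
Proof.
move=> Hh; apply: (mulfI (s_neq0 Hh)).
rewrite divff ?s_neq0 // -sM ?mulgV; first by rewrite sK.
  by [].
exact: subgroupV.
Qed.

Lemma equivariantMl f h x : E f -> H h -> f (h * x)%g = s h * f x.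
Proof.
move=> [Ef _] Hh; rewrite -[X in f X]mulg1 Ef //; last exact: subgroup1.
by rewrite (sK K1) mulr1.
Qed.

Lemma equivariantMr f k x : E f -> H k -> f (x * k)%g = s k * f x.
Proof.
move=> [Ef _] Hk; rewrite -[X in f (X * _)%g]mul1g Ef //; last exact: subgroup1.
by rewrite (sK K1) mul1r mulrC.
Qed.

Lemma equivariant_Cc f : E f -> Cc L f.
Proof.
move=> Ef; have [_ [C [cC CL fC]]] := Ef.
apply: (Cc_locally_constant oK K1 _ cC CL fC) => k x Kk.
by rewrite (equivariantMl x Ef) ?sK ?mul1r //; exact: KH.
Qed.

Lemma char_proj_in x : H x -> p x = s x.
Proof. by move=> Hx; rewrite /p /char_proj indicE mem_set // mul1r. Qed.

Lemma char_proj_notin x : ~ H x -> p x = 0.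
Proof. by move=> Hx; rewrite /p /char_proj indicE memNset // mul0r. Qed.

Lemma char_proj_equivariant : E p.
Proof.
split; last by exists H; split=> // x; exact: char_proj_notin.
move=> h k x Hh Hk; have [Hx|Hx] := pselect (H x); last first.
  rewrite !char_proj_notin ?mulr0 ?mul0r // => Hhxk; apply: Hx.
  by move: Hhxk; rewrite (subgroupMr HG) // (subgroupMl HG).
have Hhx := subgroupM HG Hh Hx.
by rewrite !char_proj_in ?sM //; exact: subgroupM.
Qed.

Let pCc : Cc L p := equivariant_Cc char_proj_equivariant.

Lemma conv_equivariant f g : E f -> E g -> E (f \* g).
Proof.
move=> Ef Eg; have cf := equivariant_Cc Ef; have cg := equivariant_Cc Eg.
split.
  move=> h k x Hh Hk.
  rewrite (Cc_convMr LG oL mu_haar hT (c := s k)) // => [|y]; last first.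
    exact: equivariantMr.
  rewrite (Cc_convMl LG oL mu_haar hT (c := s h)) // => [||y].
  - by rewrite mulrC.
  - exact: HL.
  - exact: equivariantMl.
have [_ [C [cC CL fC]]] := Ef; have [_ [D [cD DL gD]]] := Eg.
exists [set (y * z)%g | y in C & z in D]; split.
- exact: compact_mulg.
- by move=> _ [y /CL Ly [z /DL Lz <-]]; exact: subgroupM.
- exact: (Cc_conv_support mu oL fC gD).
Qed.

(** The outer factors [p] contribute one side of the equivariance each. Left equivariance alone
    makes [p \* f] locally constant, so that it may be convolved again. *)
Lemma corner_equivariant f : Cc L f -> E ((p \* f) \* p).
Proof.
move=> cf; have [_ [C [cC CL fC]]] := cf.
have pfl h x : H h -> (p \* f) (h * x)%g = s h * (p \* f) x.
  move=> Hh; rewrite (Cc_convMl LG oL mu_haar hT (c := s h)) // => [|y].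
    exact: HL.
  exact: (equivariantMl _ char_proj_equivariant).
set D := [set (y * z)%g | y in H & z in C].
have cD : compact D by exact: compact_mulg.
have DL : D `<=` L by move=> _ [y /HL Ly [z /CL Lz <-]]; exact: subgroupM.
have pfD : forall x, ~ D x -> (p \* f) x = 0.
  by apply: (Cc_conv_support mu oL) fC => y; exact: char_proj_notin.
have cpf : Cc L (p \* f).
  apply: (Cc_locally_constant oK K1 _ cD DL pfD) => k x Kk.
  by rewrite pfl ?sK ?mul1r //; exact: KH.
split.
  move=> h k x Hh Hk.
  rewrite (Cc_convMr LG oL mu_haar hT (c := s k)) // => [|y]; last first.
    exact: (equivariantMr _ char_proj_equivariant).
  rewrite (Cc_convMl LG oL mu_haar hT (c := s h)) // => [||y].
  - by rewrite mulrC.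
  - exact: HL.
  - exact: pfl.
exists [set (y * z)%g | y in D & z in H]; split.
- exact: compact_mulg.
- by move=> _ [y /DL Ly [z /HL Lz <-]]; exact: subgroupM.
- by apply: (Cc_conv_support mu oL pfD) => y; exact: char_proj_notin.
Qed.

Lemma haar_lcoset x : L x -> mu [set y | H (x^-1 * y)%g] = 1%E.
Proof.
by move=> Lx; rewrite (haar_preim_lmulg mu_haar Lx oH HL) mu_H.
Qed.

(* The integrand is constant on the left cosets of H. *)
Lemma Cc_conv_sum f g (r : seq T) x : E f -> E g ->
  uniq r -> (forall a, a \in r -> L a) ->
  (forall a b, a \in r -> b \in r -> H (a^-1 * b)%g -> a = b) ->
  (forall y, f y != 0 -> exists2 a, a \in r & H (a^-1 * y)%g) ->
  (f \* g) x = \sum_(a <- r) f a * g (a^-1 * x)%g.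
Proof.
move=> Ef Eg ur rL rH fr.
have [|_ <-] := Cintegral_sum mL (r := r) (fun a => f a * g (a^-1 * x)%g)
    (A := fun a => [set y | H (a^-1 * y)%g]) (mu := mu).
  move=> a /rL La; split; [exact: open_lmulg| |exact: haar_lcoset].
  by move=> y /HL; rewrite /= (subgroupMl LG) //; exact: subgroupV.
apply: eq_Cintegral => y _.
have [[a ar Hay]|ny] := pselect (exists2 a, a \in r & H (a^-1 * y)%g).
  rewrite (bigD1_seq a) //= indicE mem_set //= mulr1 big1_seq ?addr0.
    (* With [h = a^-1 * y], the factor [s h] coming from [f] cancels the factor [s h^-1] coming from
       [g]. *)
    have -> : y = (a * (a^-1 * y))%g by rewrite mulVKg.
    rewrite (equivariantMr _ Ef Hay) [(_ * (_ * y))^-1%g]invgM.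
    rewrite -[(_ * _ * x)%g]mulgA.
    rewrite (equivariantMl _ Eg (subgroupV HG Hay)) sV //.
    by rewrite mulrACA mulfV ?s_neq0 // mul1r.
  move=> b /andP[ba br]; rewrite indicE memNset ?mulr0 //= => Hby.
  move/eqP: ba; apply; apply: rH => //.
  have := subgroupM HG Hby (subgroupV HG Hay).
  by rewrite !gsimp.
rewrite big1_seq => [|a /andP[_ ar]]; last first.
  by rewrite indicE memNset ?mulr0 //= => Hay; apply: ny; exists a.
have [->|/fr //] := eqVneq (f y) 0; by rewrite mul0r.
Qed.

Lemma char_proj_conv f : E f -> p \* f = f.
Proof.
move=> Ef; apply/funext => x.
(* [p] is supported on the single coset [H], represented by 1. *)
rewrite (Cc_conv_sum x char_proj_equivariant Ef (r := [:: 1%g])) //.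
- by rewrite big_seq1 char_proj_in ?invg1 ?mul1g ?(sK K1) ?mul1r //; exact: subgroup1.
- by move=> a; rewrite inE => /eqP ->; exact: subgroup1.
- by move=> a b; rewrite !inE => /eqP -> /eqP ->.
move=> y py; exists 1%g; rewrite ?inE // invg1 mul1g.
by apply: contrapT => /char_proj_notin py0; rewrite py0 eqxx in py.
Qed.

(** Only the [y] in [x H] contribute to the integral at [x]. There the integrand has the constant
    value [f x], because the two values of [s] cancel, and [x H] has measure 1 for [x] in [L]. *)
Lemma conv_char_proj f : E f -> f \* p = f.
Proof.
move=> Ef; apply/funext => x; have cf := equivariant_Cc Ef.
have [Lx|Lx] := pselect (L x); last first.
  rewrite (Cc_notin cf Lx) -[RHS](Cintegral0 mu mL); apply: eq_Cintegral => y Ly.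
  rewrite char_proj_notin ?mulr0 // => /HL.
  by rewrite (subgroupMl LG) //; exact: subgroupV.
rewrite /Cc_conv (@eq_Cintegral _ _ _ _ _
  (fun y => f x * \1_[set y | H (x^-1 * y)%g] y)).
  rewrite (CintegralZ mL); last first.
    apply: (Cintegrable_indic mL); first exact: open_lmulg.
      by move=> y /HL; rewrite /= (subgroupMl LG) //; exact: subgroupV.
    by rewrite [X in (X < _)%E]haar_lcoset ?ltry.
  rewrite (Cintegral_indic mu mL); last 2 first.
  - exact: open_lmulg.
  - by move=> y /HL; rewrite /= (subgroupMl LG) //; exact: subgroupV.
  by rewrite haar_lcoset // mulr1.
move=> y _; have yx : (y^-1 * x = (x^-1 * y)^-1)%g by rewrite !gsimp.
have [Hxy|Hxy] := pselect (H (x^-1 * y)%g).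
  rewrite indicE mem_set // mulr1 -[X in f X](mulVKg x y).
  rewrite (equivariantMr _ Ef Hxy) yx char_proj_in ?sV //; last exact: subgroupV.
  by rewrite mulrAC mulfV ?s_neq0 // mul1r.
rewrite indicE memNset // mulr0 char_proj_notin ?mulr0 //.
by rewrite yx (subgroupVE HG).
Qed.

Lemma Cc_cornerE : Cc_corner L mu p = E.
Proof.
apply/seteqP; split=> [_ [f cf <-]|f Ef]; first exact: corner_equivariant.
exists f; first exact: equivariant_Cc.
by rewrite char_proj_conv // conv_char_proj.
Qed.

(** * The modular function and the involution *)

Variable Delta : T -> R.
Hypothesis Delta_modular : modular_function L mu Delta.

Lemma modular_functionE t : L t -> mu [set (a * t : T)%g | a in H] = (Delta t)%:E.
Proof.
move=> Lt.
by rewrite (Delta_modular Lt (open_measurable_borel oH) HL) mu_H mule1.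
Qed.

Lemma modular_functionMl h t : H h -> L t -> Delta (h * t)%g = Delta t.
Proof.
move=> Hh Lt; apply/EFin_inj; rewrite -!modular_functionE //; last first.
  by apply: (subgroupM LG) => //; exact: HL.
congr (mu _); apply/seteqP; split=> _ [a Ha <-].
  by exists (a * h)%g; [exact: subgroupM | rewrite mulgA].
exists (a * h^-1)%g; last by rewrite !gsimp.
by apply: (subgroupM HG) => //; exact: subgroupV.
Qed.

(** [H h = H] gives [Delta h = 1]; right translation of the set [H t] by [h] then preserves its
    measure. *)
Lemma modular_functionMr h t : H h -> L t -> Delta (t * h)%g = Delta t.
Proof.
move=> Hh Lt.
have Dh : Delta h = 1.
  apply/EFin_inj; rewrite -modular_functionE ?HL //; last exact: HL.
  transitivity (mu H); last exact: mu_H.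
  congr (mu _); apply/seteqP; split=> [_ [a Ha <-]|a Ha]; first exact: subgroupM.
  exists (a * h^-1)%g; last by rewrite mulgVK.
  by apply: (subgroupM HG) => //; exact: subgroupV.
have Lh := HL Hh.
have oHt : open [set (a * t : T)%g | a in H].
  rewrite (_ : [set _ | _ in _] = [set y | H (y * t^-1)%g]).
    exact: open_rmulg.
  apply/seteqP; split=> [_ [a Ha <-]|y Hy]; first by rewrite /= mulgK.
  by exists (y * t^-1)%g => //; rewrite mulgVK.
have HtL : [set (a * t : T)%g | a in H] `<=` L.
  by move=> _ [a /HL La <-]; exact: subgroupM.
apply/EFin_inj; rewrite -!modular_functionE //; last exact: subgroupM.
rewrite -[RHS]mul1e -Dh -(Delta_modular Lh (open_measurable_borel oHt) HtL).
congr (mu _); apply/seteqP; split=> [_ [a Ha <-]|_ [_ [a Ha <-] <-]].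
  by exists (a * t)%g; [exists a | rewrite mulgA].
by exists a; rewrite ?mulgA.
Qed.

Lemma star_equivariant f : E f -> E (Cc_star Delta f).
Proof.
move=> Ef; have cf := equivariant_Cc Ef.
have [_ [C [cC CL fC]]] := Ef; split; last first.
  exists [set x^-1%g | x in C]; split; first exact: compact_invg.
    by move=> _ [x /CL Lx <-]; exact: subgroupV.
  move=> x Cx; rewrite /Cc_star fC ?conjC0 ?mulr0 //.
  by move=> Cx'; apply: Cx; exists x^-1%g; rewrite ?invgK.
move=> h k x Hh Hk; rewrite /Cc_star.
have HhV := subgroupV HG Hh; have HkV := subgroupV HG Hk.
rewrite !invgM (equivariantMl _ Ef) // (equivariantMr _ Ef) //.
(* [Delta] is controlled on [L] only; elsewhere [f] vanishes. *)
have [Lx|Lx] := pselect (L x^-1%g); last first.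
  by rewrite (Cc_notin cf Lx) !mulr0 conjC0 !(mulr0, mul0r).
rewrite modular_functionMl ?modular_functionMr //; last first.
  by apply: (subgroupM LG) => //; exact: HL.
rewrite !rmorphM /= !sV //.
(* Inverting the argument inverts the values of [s]; conjugation undoes this because they have
   modulus 1. *)
have conjsV u : H u -> ((s u)^-1)^* = s u.
  by move=> Hu; rewrite invC_norm s_norm // expr1n invr1 mul1r conjCK.
rewrite !conjsV //.
by rewrite [s k * _]mulrC !mulrA; congr (_ * _ * _); rewrite mulrC.
Qed.

End Corner.

(** * Restriction to the dense subgroup *)

Lemma lcoset_eqP (G : groupType) (H : set G) x y : subgroup H ->
  lcoset H x = lcoset H y <-> H (x^-1 * y)%g.
Proof.
move=> HG; split=> [xy|Hxy].
  have [h Hh <-] : lcoset H x y.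
    by rewrite xy; exists 1%g; [exact: subgroup1 | rewrite mulg1].
  by rewrite mulKg.
apply/seteqP; split=> _ [h Hh <-].
  exists ((x^-1 * y)^-1 * h)%g; last by rewrite !gsimp.
  by apply: (subgroupM HG) => //; exact: subgroupV.
exists ((x^-1 * y) * h)%g; last by rewrite !gsimp.
exact: subgroupM.
Qed.

Lemma lcoset_xget (G : groupType) (H M : set G) c : subgroup H ->
  lcosets M H c -> lcoset H (xget 1%g c) = c.
Proof.
move=> HG [x _ <-]; apply/esym/lcoset_eqP => //.
have [h Hh <-] : lcoset H x (xget 1%g (lcoset H x)).
  by apply: xgetPex; exists x; exists 1%g; [exact: subgroup1 | rewrite mulg1].
by rewrite mulKg.
Qed.

Lemma dcoset_lcoset (G : groupType) (H : set G) x h : subgroup H -> H h ->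
  dcoset H (x * h)%g = dcoset H x.
Proof.
move=> HG Hh; apply/seteqP; split=> _ [a Ha [b Hb <-]].
  by exists a => //; exists (h * b)%g; [exact: subgroupM | rewrite !gsimp].
exists a => //; exists (h^-1 * b)%g; last by rewrite !gsimp.
by apply: (subgroupM HG) => //; exact: subgroupV.
Qed.

(** * Haar measure and indices *)

Section HaarIndex.
Variables (R : realType) (G : groupType) (T : topologicalGroupType).
Variables (i : {multiplicative G -> T}) (L : set T).
Variable mu : {measure set (borel T) -> \bar R}.
Hypothesis mu_haar : haar_measure L mu.
Variables (M N : set G) (Mt Nt : set T).
Hypothesis NG : subgroup N.
Hypothesis NtG : subgroup Nt.
Hypothesis MtG : subgroup Mt.
Hypothesis oNt : open Nt.
Hypothesis MtL : Mt `<=` L.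
Hypothesis NMt : Nt `<=` Mt.
Hypothesis iM : forall x, M x -> Mt (i x).
Hypothesis iN : forall x, Nt (i x) = N x.
Hypothesis NM : N `<=` M.
Hypothesis MG : subgroup M.
Hypothesis Mt_approx : forall t, Mt t -> exists2 x, M x & Nt ((i x)^-1 * t)%g.
Hypothesis fMN : finite_set (lcosets M N).

(** [Mt] is partitioned into translates of [Nt] by representatives of the cosets of [N] in [M]:
    [Mt_approx] shows that they cover, [iN] that they are disjoint. This is applied to [K] in [H]
    and to [K] intersected with a conjugate in [K]. *)
Lemma haar_gindex : (mu Mt = (gindex M N)%:R%:E * mu Nt)%E.
Proof.
pose A (c : set G) := [set t | Nt ((i (xget 1%g c))^-1 * t)%g].
have Mc c : lcosets M N c -> M (xget 1%g c).
  move=> /[dup] /(lcoset_xget NG) cE [x Mx xc].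
  have /(lcoset_eqP _ _ NG) Nx : lcoset N x = lcoset N (xget 1%g c) by rewrite cE.
  by rewrite -(mulVKg x (xget 1%g c)); apply: (subgroupM MG) => //; exact: NM.
have -> : Mt = \bigcup_(c in lcosets M N) A c.
  apply/seteqP; split=> [t Mt_t|t [c /Mc Mcx At]]; last first.
    have := subgroupM MtG (iM Mcx) (NMt At).
    by rewrite mulVKg.
  have [x Mx Nx] := Mt_approx Mt_t.
  exists (lcoset N x); first by exists x.
  have Nc : N ((xget 1%g (lcoset N x))^-1 * x)%g.
    by apply/(lcoset_eqP _ _ NG); apply: (lcoset_xget (M := M) NG); exists x.
  rewrite /A /=; move: Nc; rewrite -iN gmulfM multiplicativeV.
  by move=> /(subgroupM NtG) /(_ Nx); rewrite !gsimp.
rewrite measure_fin_bigcup //; last 2 first.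
- move=> c d cC dC [t [ct dt]].
  rewrite -(lcoset_xget NG cC) -(lcoset_xget NG dC); apply/(lcoset_eqP _ _ NG).
  rewrite -iN gmulfM multiplicativeV.
  have := subgroupM NtG ct (subgroupV NtG dt).
  by rewrite !gsimp.
- by move=> c cC; apply: open_measurable_borel; exact: open_lmulg.
have NtL : Nt `<=` L by move=> t /NMt/MtL.
rewrite (eq_fsbigr (fun=> mu Nt)) => [|c /set_mem/Mc/iM/MtL Lc]; last first.
  exact: (haar_preim_lmulg mu_haar Lc oNt NtL).
rewrite fsbig_finite // big_const_seq count_predT /gindex.
elim: (size _) => [|n IH]; first by rewrite mul0e.
rewrite iterS IH -addn1 natrD EFinD ge0_muleDl ?lee_fin ?ler0n //.
by rewrite mul1e addeC.
Qed.

End HaarIndex.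

(** * Extension, restriction and the isomorphism *)

Section Isomorphism.
Variables (R : realType) (G : groupType) (H : set G) (sigma : G -> R[i]).
Hypothesis Hsigma : reduced_hecke_triple H sigma.
Variables (T : topologicalGroupType) (i : {multiplicative G -> T}).
Let K := char_ker H sigma.
Hypothesis iT : hecke_completion K i.
Variable s : T -> R[i].
Hypothesis s_ext : continuous_extension i H sigma s.
Let B := compat_set H sigma.
Hypothesis BG : subgroup B.
Let Hs : set T := closure (i @` H).
Let Ks : set T := closure (i @` K).
Let Bs : set T := compat_set Hs s.
Variable mu : {measure set (borel T) -> \bar R}.
Hypothesis mu_haar : haar_measure Bs mu.
Hypothesis mu_Hs : mu Hs = 1%E.
Variable Delta : T -> R.
Hypothesis Delta_modular : modular_function Bs mu Delta.

Let E := Cc_equivariant Bs Hs s.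

Let hT : hausdorff_space T := hecke_completion_hausdorff iT.
Let HG : subgroup H := hecke_triple_subgroup Hsigma.
Let KG : subgroup K := char_ker_subgroup Hsigma.
Let KsG : subgroup Ks := closure_image_subgroup i KG.
Let HsG : subgroup Hs := closure_image_subgroup i HG.
Let oKs : open Ks := completion_subgroup_open KG iT.
Let oHs : open Hs := completion_closure_open Hsigma iT.
Let cHs : compact Hs := completion_closure_compact Hsigma iT.
Let Ks1 : Ks 1%g := subgroup1 KsG.
Let KsHs : Ks `<=` Hs := char_ker_closure_sub (i := i).
Let BsG : subgroup Bs := completion_compat_subgroup Hsigma iT s_ext BG.
Let oBs : open Bs := completion_compat_open Hsigma iT s_ext BG.
Let HsBs : Hs `<=` Bs := completion_sub_compat Hsigma iT s_ext BG.
Let KsE x : Ks (i x) = K x := completion_preim_subgroup KG iT x.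
Let HsE x : Hs (i x) = H x := completion_preim Hsigma iT x.
Let BsE x : Bs (i x) = B x := completion_compat_preim Hsigma iT s_ext x.
Let sE h : H h -> s (i h) = sigma h := proj2 s_ext h.
Let sM := extensionM Hsigma iT s_ext.
Let s_norm := extension_norm Hsigma iT s_ext.
Let sK := extension_ker Hsigma iT s_ext.
Let EMr := fun f h x => @equivariantMr R T Bs Hs Ks s HsG Ks1 sK f h x.
Let ECc := fun f => @equivariant_Cc R T Bs Hs Ks s HsG oKs Ks1 KsHs sK f.
Let coset t : exists x, Ks ((i x)^-1 * t)%g := completion_coset Hsigma iT t.

Let conj_approx y t :
  exists x, Ks ((i x)^-1 * t)%g /\ Ks ((i y)^-1 * ((i x)^-1 * t) * i y)%g.
Proof.
have [|x [/= Kx Kyx]] := completion_approx iT t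
  (openI oKs (completion_conj_open KG iT y)).
  by split; rewrite /= ?mulg1 ?mulVg; exact: (subgroup1 KsG).
by exists x.
Qed.

(** Compute [f] at [h * x = x * (x^-1 * h * x)] from both sides and cancel [f x]. *)
Lemma hecke_algebra_compat f x : hecke_algebra H sigma f -> f x != 0 -> B x.
Proof.
move=> [fH _] fx; apply/compat_setE => h Hh Hxh.
have := fH _ _ x Hh (subgroup1 HG).
have := fH _ _ x (subgroup1 HG) Hxh.
rewrite (character1 Hsigma) mul1r mulr1 !mulg1 mul1g !mulgA mulgV mul1g => ->.
by rewrite mulrC => /(mulIf fx).
Qed.

(** Elements of the Hecke algebra are right invariant under [K], so for them the choice made by
    [xget] is immaterial ([hecke_extensionE]); by [coset] there is always a point to choose. *)
Definition hecke_extension (f : G -> R[i]) : T -> R[i] :=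
  fun t => f (xget 1%g [set x | Ks ((i x)^-1 * t)%g]).

Lemma hecke_extensionE f x t : hecke_algebra H sigma f ->
  Ks ((i x)^-1 * t)%g -> hecke_extension f t = f x.
Proof.
move=> [fH _] Kx; rewrite /hecke_extension.
set y := xget _ _.
have Ky : Ks ((i y)^-1 * t)%g.
  have : [set x | Ks ((i x)^-1 * t)%g] y by apply: xgetPex; exists x.
  by [].
have [Hxy sxy] : K (x^-1 * y)%g.
  rewrite -KsE gmulfM multiplicativeV.
  have := subgroupM KsG Kx (subgroupV KsG Ky).
  by rewrite !gsimp.
have := fH _ _ x (subgroup1 HG) Hxy.
by rewrite mul1g mulVKg (character1 Hsigma) sxy mul1r mulr1.
Qed.

Lemma compact_cosets C : compact C ->
  exists r : seq G, forall t, C t -> exists2 x, x \in r & Ks ((i x)^-1 * t)%g.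
Proof.
rewrite compact_cover => /(_ G setT (fun x => [set t | Ks ((i x)^-1 * t)%g])).
case=> [x _|t _|r _ Cr]; first exact: open_lmulg.
  by have [x Kx] := coset t; exists x.
by exists r => t /Cr [x /= xr Kx]; exists x.
Qed.

Lemma equivariant_restrict F : E F -> hecke_algebra H sigma (F \o i).
Proof.
move=> EF; have [EF1 [C [cC CB FC]]] := EF; split.
  move=> h k x Hh Hk /=; rewrite !gmulfM EF1 ?HsE // !sE //.
have [r rC] := compact_cosets cC.
apply: (@sub_finite_set _ _ [set dcoset H x | x in [set` r]]); last first.
  exact/finite_image/finite_seq.
move=> _ [x /= Fx <-].
have /rC[y yr] : C (i x).
  by apply: contrapT => /FC Fx0; rewrite Fx0 eqxx in Fx.
rewrite -multiplicativeV -gmulfM KsE => -[Hyx _].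
by exists y => //; rewrite -(mulVKg y x) dcoset_lcoset.
Qed.

Lemma hecke_extension_equivariant f :
  hecke_algebra H sigma f -> E (hecke_extension f).
Proof.
move=> Af; have [fH fF] := Af; split.
  (* Approximation goes from right to left: [y] for [k], then [x] for [t] up to conjugation by [y],
     then [z] for [h] up to conjugation by [x * y]. Then [z * x * y] approximates [h * t * k]. *)
  move=> h k t Hh Hk; have [y Ky] := coset k.
  have [x [Kx Kyx]] := conj_approx y t.
  have [z [Kz Kxyz]] := conj_approx (x * y)%g h.
  rewrite (hecke_extensionE Af Kx) (@hecke_extensionE f (z * x * y)%g) //.
    rewrite fH.
    - rewrite (extensionE Hsigma iT s_ext Hh Kz).
      by rewrite (extensionE Hsigma iT s_ext Hk Ky).
    - by rewrite -(completion_cosetE Hsigma iT Kz).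
    - by rewrite -(completion_cosetE Hsigma iT Ky).
  have := subgroupM KsG (subgroupM KsG Kxyz Kyx) Ky.
  by rewrite !gmulfM !gsimp.
have /finite_seqP[r fr] := fF.
(* Representatives are taken where [f] is nonzero: they lie in [B], so their double cosets under
   [Hs] lie in [Bs]. *)
pose rep c := xget 1%g [set x | f x != 0 /\ dcoset H x = c].
have repP x : f x != 0 ->
    [/\ rep (dcoset H x) \in [seq rep c | c <- r], f (rep (dcoset H x)) != 0 &
        dcoset H (rep (dcoset H x)) = dcoset H x].
  move=> fx.
  have [fx' xx'] : [set y | f y != 0 /\ dcoset H y = dcoset H x] (rep (dcoset H x)).
    by apply: xgetPex; exists x.
  split=> //; apply/mapP; exists (dcoset H x) => //.
  by have : [set` r] (dcoset H x) by rewrite -fr; exists x.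
pose D x := [set (a * b)%g |
  a in [set (a * b)%g | a in Hs & b in [set i x]] & b in Hs].
exists (\big[setU/set0]_(x <- [seq rep c | c <- r] | f x != 0) D x); split.
- apply: bigsetU_compact => x _; apply: compact_mulg => //.
  by apply: compact_mulg => //; exact: compact_set1.
- rewrite -bigcup_seq_cond => t [x /= /andP[_ fx]].
  move=> [_ [a /HsBs Ba [_ -> <-]] [b /HsBs Bb <-]].
  apply: (subgroupM BsG) => //; apply: (subgroupM BsG) => //.
  by rewrite BsE; exact: hecke_algebra_compat fx.
move=> t Dt; have [x Kx] := coset t.
rewrite (hecke_extensionE Af Kx); apply/eqP/negPn/negP => fx; apply: Dt.
have [] := repP _ fx; set y := rep _ => yr fy yx.
rewrite -bigcup_seq_cond; exists y; first by rewrite /= yr fy.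
have : dcoset H x x.
  exists 1%g; first exact: subgroup1.
  by exists 1%g; [exact: subgroup1 | rewrite mul1g mulg1].
rewrite -yx => -[h Hh [k Hk hyk]].
exists (i h * i y)%g; first by exists (i h); [rewrite HsE | exists (i y)].
exists (i k * ((i x)^-1 * t))%g.
  by apply: (subgroupM HsG); [rewrite HsE | exact: KsHs].
by rewrite !mulgA -!gmulfM hyk mulgV mul1g.
Qed.

Lemma hecke_extensionK f : hecke_algebra H sigma f -> hecke_extension f \o i = f.
Proof.
move=> Af; apply/funext => x /=; apply: hecke_extensionE => //.
by rewrite mulVg.
Qed.

Lemma restrictK F : E F -> hecke_extension (F \o i) = F.
Proof.
move=> EF; apply/funext => t; have [x Kx] := coset t.
rewrite (hecke_extensionE (equivariant_restrict EF) Kx) /=.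
rewrite -[in RHS](mulVKg (i x) t) (EMr _ EF (KsHs Kx)) sK ?mul1r //.
Qed.

(** Both sides become the same finite sum, over the cosets of [H] at whose chosen representative [F]
    is nonzero. *)
Lemma hecke_conv_restrict F F' : E F -> E F' ->
  hecke_conv H (F \o i) (F' \o i) = Cc_conv Bs mu F F' \o i.
Proof.
move=> EF EF'; apply/funext => x /=.
pose D := [set c | lcosets [set: G] H c /\ F (i (xget 1%g c)) != 0].
have /finite_seqP[r0 Dr0] : finite_set D.
  have [_ [C [cC CB FC]]] := EF; have [q qC] := compact_cosets cC.
  apply: (@sub_finite_set _ _ (lcoset H @` [set` q])); last first.
    exact/finite_image/finite_seq.
  move=> c [cH Fc].
  have /qC[y yq] : C (i (xget 1%g c)).
    by apply: contrapT => /FC Fx0; rewrite Fx0 eqxx in Fc.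
  rewrite -multiplicativeV -gmulfM KsE => -[Hyc _].
  by exists y => //; rewrite -(lcoset_xget HG cH); exact/lcoset_eqP.
pose r := undup r0.
have Dr c : D c <-> c \in r by rewrite Dr0 /r mem_undup.
have rH c d : c \in r -> d \in r -> H ((xget 1%g c)^-1 * xget 1%g d)%g -> c = d.
  move=> /Dr[cH _] /Dr[dH _] /(lcoset_eqP _ _ HG).
  by rewrite (lcoset_xget HG cH) (lcoset_xget HG dH).
rewrite (@Cc_conv_sum _ _ _ _ _ _ _ BsG oBs HsG oHs HsBs Ks1 sM s_norm sK
  mu_haar mu_Hs F F' [seq i (xget 1%g c) | c <- r] (i x) EF EF').
- rewrite big_map /hecke_conv (fsbigE r) ?undup_uniq //.
  + rewrite big_seq_cond [RHS]big_seq; apply: eq_big => c.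
      by rewrite andb_idr // => /Dr[cH _]; exact: mem_set.
    by move=> _ /=; rewrite gmulfM multiplicativeV.
  + by move=> c /= /Dr[].
  + move=> c cH cr /=; have [->|Fc] := eqVneq (F (i (xget 1%g c))) 0.
      by rewrite mul0r.
    by move/negP: cr; case; apply/Dr.
(* If two representatives have the same image under [i], their quotient is in [K], hence in [H], and
   the cosets agree. *)
- rewrite map_inj_in_uniq ?undup_uniq // => c d cr dr icd.
  apply: rH => //; have [] // : K ((xget 1%g c)^-1 * xget 1%g d)%g.
  by rewrite -KsE gmulfM multiplicativeV icd mulVg.
- move=> _ /mapP[c /Dr[_ Fc] ->]; apply: contrapT => Bc.
  by move/eqP: Fc; apply; exact: (Cc_notin (ECc EF)).
- move=> _ _ /mapP[c cr ->] /mapP[d dr ->].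
  by rewrite -multiplicativeV -gmulfM HsE => /(rH _ _ cr dr) ->.
(* The representative chosen in [y H] may differ from [y], but its image is still in [t * Hs], and
   [F] is nonzero there by equivariance. *)
move=> t Ft; have [y Ky] := coset t.
have cH : lcosets [set: G] H (lcoset H y) by exists y.
have Hyc : H (y^-1 * xget 1%g (lcoset H y))%g.
  by apply/(lcoset_eqP _ _ HG); rewrite (lcoset_xget HG cH).
have Hct : Hs ((i (xget 1%g (lcoset H y)))^-1 * t)%g.
  have := subgroupM HsG
    (subgroupV HsG (_ : Hs (i (y^-1 * xget 1%g (lcoset H y))%g))) (KsHs Ky).
  by rewrite HsE => /(_ Hyc); rewrite gmulfM multiplicativeV !gsimp.
exists (i (xget 1%g (lcoset H y))) => //.
apply: map_f; apply/Dr; split=> //.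
move: Ft; rewrite -(mulVKg (i (xget 1%g (lcoset H y))) t) (EMr _ EF Hct).
by rewrite mulf_eq0 negb_or => /andP[].
Qed.

(** * Comparison of the involutions *)

Let mu_fin (U : set T) : open U -> U `<=` Hs -> exists r : R, mu U = r%:E.
Proof.
move=> oU UH; exists (fine (mu U)); rewrite fineK // ge0_fin_numE //.
apply: (@le_lt_trans _ _ (mu Hs)); last by rewrite [X in (X < _)%E]mu_Hs ltry.
by apply: le_measure => //; apply: mem_set; exact: open_measurable_borel.
Qed.

(** The measure 1 of [Hs] is a multiple of [mu Ks], by the index of [K] in [H]. *)
Lemma haar_char_ker_neq0 : exists2 r : R, r != 0 & mu Ks = r%:E.
Proof.
have fHK : finite_set (lcosets H K).
  have [D HD] := character_cosets Hsigma.
  apply: (@sub_finite_set _ _ (lcoset K @` [set` D])); last first.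
    exact/finite_image/finite_seq.
  move=> _ [h Hh <-]; have [d dD Kd] := HD _ Hh.
  by exists d => //; exact/lcoset_eqP.
have KH : K `<=` H by move=> x [].
have : mu Hs = ((gindex H K)%:R%:E * mu Ks)%E.
  apply: (haar_gindex mu_haar KG KsG HsG oKs HsBs KsHs (i := i)) => //.
  - by move=> x Hx; rewrite HsE.
  - move=> t Ht; have [x Kx] := coset t; exists x => //.
    by rewrite -(completion_cosetE Hsigma iT Kx).
rewrite [X in X = _]mu_Hs.
have [r ->] := mu_fin oKs KsHs.
move=> nr; exists r => //; apply/eqP => r0; move: nr; rewrite r0 mule0 => /eqP.
by rewrite onee_eq0.
Qed.

Let Kconj y : set T := [set t | Ks t /\ Ks ((i y)^-1 * t * i y)%g].

Lemma hecke_index y : mu Ks = ((gindex K (K `&` lconj y K))%:R%:E * mu (Kconj y))%E.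
Proof.
have KjG : subgroup (Kconj y).
  apply/subgroupE; split; first by split; rewrite ?mulg1 ?mulVg.
  move=> t u [Kt Kyt] [Ku Kyu]; split; first by case/subgroupE: KsG => _; apply.
  have := subgroupM KsG Kyt (subgroupV KsG Kyu).
  by rewrite !gsimp.
have KyG : subgroup (K `&` lconj y K).
  apply/subgroupE; split; first by split; rewrite ?lconjE ?mulg1 ?mulVg; exact: subgroup1.
  move=> x z [Kx]; rewrite lconjE => Kyx [Kz]; rewrite lconjE => Kyz.
  split; first by case/subgroupE: KG => _; apply.
  rewrite lconjE; have := subgroupM KG Kyx (subgroupV KG Kyz).
  by rewrite !gsimp.
apply: (haar_gindex mu_haar KyG KjG KsG _ _ _ _ _ _ KG (i := i)).
- by apply: openI => //; exact: (completion_conj_open KG iT y).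
- by move=> t /KsHs/HsBs.
- by move=> t [].
- by move=> x; rewrite KsE.
- move=> x; apply/propext; rewrite /Kconj /= /setI /= lconjE.
  by rewrite -multiplicativeV -!gmulfM !KsE.
- by move=> x [].
- move=> t Kt; have [x [Kx Kyx]] := conj_approx y t; exists x => //.
  rewrite -KsE -(mulVKg t (i x)); apply: (subgroupM KsG) => //.
  by have := subgroupV KsG Kx; rewrite !gsimp.
- by case: Hsigma => _ [[_ +] _]; exact.
Qed.

Lemma hecke_modularE x : B x -> hecke_modular R K x = Delta (i x).
Proof.
move=> Bx; have Bix : Bs (i x) by rewrite BsE.
have [k k0 kE] := haar_char_ker_neq0.
have oKj y : open (Kconj y).
  by apply: openI => //; exact: (completion_conj_open KG iT y).
have KjB y : Kconj y `<=` Bs by move=> t [/KsHs/HsBs].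
have fin y : exists2 m : R, mu (Kconj y) = m%:E &
    k = (gindex K (K `&` lconj y K))%:R * m.
  have [|m mE] := mu_fin (oKj y); first by move=> t [/KsHs].
  exists m => //; apply/EFin_inj; rewrite EFinM -mE -kE; exact: hecke_index.
have [m mE km] := fin x; have [m' mE' km'] := fin x^-1%g.
(* [Kconj x^-1] is the set [(i x)^-1 * Kconj x * i x]: the right translation scales the measure by
   [Delta (i x)], the left one preserves it. *)
have mm' : m' = Delta (i x) * m.
  apply/EFin_inj; rewrite EFinM -mE -mE'.
  rewrite -(Delta_modular Bix (open_measurable_borel (oKj x)) (KjB x)).
  have oKx : open [set (a * i x : T)%g | a in Kconj x].
    rewrite (_ : [set _ | _ in _] = [set y | Kconj x (y * (i x)^-1)%g]).
      exact: open_rmulg.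
    apply/seteqP; split=> [_ [a Ha <-]|y Hy]; first by rewrite /= mulgK.
    by exists (y * (i x)^-1)%g => //; rewrite mulgVK.
  have KxB : [set (a * i x : T)%g | a in Kconj x] `<=` Bs.
    by move=> _ [a /KjB Ba <-]; exact: (subgroupM BsG).
  rewrite -(haar_preim_lmulg mu_haar (subgroupV BsG Bix) oKx KxB).
  have KjV t : Kconj x^-1%g t = (Ks t /\ Ks (i x * t * (i x)^-1)%g).
    by rewrite /Kconj /= multiplicativeV invgK.
  congr (mu _); apply/seteqP; split=> [t|t /=]; rewrite KjV invgK.
    move=> [Kt Kxt]; exists (i x * t * (i x)^-1)%g; last by rewrite !gsimp.
    by split=> //; rewrite !gsimp.
  case=> a [Ka Kxa] xt.
  have {xt}-> : t = ((i x)^-1 * (a * i x))%g by rewrite xt mulKg.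
  by rewrite !mulgA mulgV mul1g mulgK; split.
(* Both factorisations of the nonzero [k] have nonzero factors, which may be cancelled. *)
have m0 : m != 0 by apply/eqP => m0; move: k0; rewrite km m0 mulr0 eqxx.
have n0' : (gindex K (K `&` lconj x^-1%g K))%:R != 0 :> R.
  by apply/eqP => n0; move: k0; rewrite km' n0 mul0r eqxx.
rewrite /hecke_modular; apply: (mulIf n0'); rewrite mulfVK //.
apply: (mulIf m0); rewrite -km km' mm'.
by rewrite mulrCA mulrA.
Qed.

Lemma hecke_star_restrict F : E F ->
  hecke_star K (F \o i) = Cc_star Delta F \o i.
Proof.
move=> EF; apply/funext => x; rewrite /hecke_star /Cc_star /= multiplicativeV.
have [Bx|Bx] := pselect (B x^-1%g).
  by rewrite hecke_modularE // multiplicativeV.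
(* Off [B] the two modular factors are not compared, but [F] vanishes. *)
by rewrite (Cc_notin (ECc EF)) -?multiplicativeV ?BsE // conjC0 !mulr0.
Qed.

(** * The star-algebra isomorphism *)

Lemma equivariant0 : E (fun=> 0).
Proof.
split; first by move=> *; rewrite mulr0 mul0r.
by exists set0; split=> //; exact: compact0.
Qed.

Lemma equivariantZD (a : R[i]) F F' : E F -> E F' -> E (fun t => a * F t + F' t).
Proof.
move=> [FH [C [cC CB FC]]] [FH' [C' [cC' CB' FC']]]; split.
  by move=> h k t Hh Hk; rewrite FH // FH' // mulrDr mulrDl !mulrA [a * _]mulrC.
exists (C `|` C'); split; first exact: compactU.
  by move=> t [/CB|/CB'].
move=> t Ct; rewrite FC ?FC' ?mulr0 ?addr0 // => Ct'; apply: Ct; first by right.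
by left.
Qed.

Let Econv F F' : E F -> E F' -> E (Cc_conv Bs mu F F').
Proof. exact: (conv_equivariant hT BsG oBs HsG HsBs oKs Ks1 KsHs sK mu_haar). Qed.

Let Estar F : E F -> E (Cc_star Delta F).
Proof.
exact: (star_equivariant BsG HsG oHs HsBs oKs Ks1 KsHs sM s_norm sK mu_Hs
  Delta_modular).
Qed.

(** Every element of the Hecke algebra is the restriction of its extension, so closure under the
    operations is transported from [E]. *)
Lemma hecke_star_isomorphic : star_isomorphic
  (hecke_algebra H sigma) (hecke_conv H) (hecke_star K)
  (Cc_corner Bs mu (char_proj Hs s)) (Cc_conv Bs mu) (Cc_star Delta).
Proof.
rewrite (Cc_cornerE hT BsG oBs HsG oHs cHs HsBs oKs Ks1 KsHs sM s_norm sK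
  mu_haar mu_Hs) -/E.
have ext := hecke_extension_equivariant; have res := equivariant_restrict.
split; first split.
- exact: (res _ equivariant0).
- move=> a f g Af Ag; rewrite -(hecke_extensionK Af) -(hecke_extensionK Ag).
  exact: (res _ (equivariantZD a (ext _ Af) (ext _ Ag))).
- move=> f g Af Ag; rewrite -(hecke_extensionK Af) -(hecke_extensionK Ag).
  by rewrite hecke_conv_restrict; [apply: res; apply: Econv| |]; exact: ext.
- move=> f Af; rewrite -(hecke_extensionK Af) hecke_star_restrict; last exact: ext.
  by apply: res; apply: Estar; exact: ext.
- by split; [exact: equivariant0|exact: equivariantZD|exact: Econv|exact: Estar].
exists hecke_extension; split.
- split; first exact: ext.
    move=> f g /set_mem Af /set_mem Ag fg.
    by rewrite -(hecke_extensionK Af) fg hecke_extensionK.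
  by move=> F EF; exists (F \o i); [exact: res | exact: restrictK].
(* Linearity holds by computation: [hecke_extension f t] evaluates [f] at a point that depends on
   [t] alone. *)
- by [].
- move=> f g Af Ag.
  rewrite -{1}(hecke_extensionK Af) -{1}(hecke_extensionK Ag).
  rewrite hecke_conv_restrict; [|exact: ext|exact: ext].
  by apply: restrictK; apply: Econv; exact: ext.
- move=> f Af; rewrite -{1}(hecke_extensionK Af).
  rewrite hecke_star_restrict; last exact: ext.
  by apply: restrictK; apply: Estar; exact: ext.
Qed.

End Isomorphism.

Unset Implicit Arguments.

Theorem proposition3p5 (R : realType) (G : groupType)
    (H : set G) (sigma : G -> R[i])
    (Hsigma : reduced_hecke_triple H sigma)
    (* the Schlichting completion (Gs, Hs, sigmas) *)
    (Gs : topologicalGroupType) (i : {multiplicative G -> Gs})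
    (Gs_completion : hecke_completion (char_ker H sigma) i)
    (Hs : set Gs) (HsE : Hs = closure (i @` H))
    (sigmas : Gs -> R[i])
    (sigmas_ext : continuous_extension i H sigma sigmas)
    (B_subgroup : subgroup (compat_set H sigma))
    (Bs : set Gs) (BsE : Bs = compat_set Hs sigmas)
    (mu : {measure set (borel Gs) -> \bar R})
    (mu_haar : haar_measure Bs mu) (mu_Hs : mu Hs = 1%E)
    (Delta : Gs -> R) (Delta_modular : modular_function Bs mu Delta) :
  star_isomorphic
    (hecke_algebra H sigma) (hecke_conv H) (hecke_star (char_ker H sigma))
    (Cc_corner Bs mu (char_proj Hs sigmas)) (Cc_conv Bs mu) (Cc_star Delta).
Proof.
subst Bs; subst Hs.
exact: (hecke_star_isomorphic Hsigma Gs_completion sigmas_ext B_subgroup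
  mu_haar mu_Hs Delta_modular).
Qed.
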